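(* Suppose that the following statement holds: for every bipartite graph $F$ and every real $\alpha>0$, if $\mathrm{ex}(n,F)=O(n^{1+\alpha})$ then $\mathrm{ex}(n,\mathrm{sub}(F))=O(n^{1+\alpha/2})$. Then for every rational number $r\in[1,2]$ there exists a graph $F$ with $\mathrm{ex}(n,F)=\Theta(n^r)$.
   Context: $\mathrm{ex}(n,F)$ is the maximum number of edges in an $n$-vertex graph containing no subgraph isomorphic to $F$. For a graph $F$, its $1$-subdivision $\mathrm{sub}(F)$ is the graph obtained by replacing every edge of $F$ by a path of length two, these paths being pairwise internally vertex-disjoint (each with a new middle vertex). *)

(* Defs.v *)
From Stdlib Require Import Reals QArith Qreals.
From HB Require Import structures.
From mathcomp Require Import all_boot.
Set Implicit Arguments. Unset Strict Implicit. Unset Printing Implicit Defensive.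

Definition simple_graph (V : finType) (e : rel V) : Prop :=
  (forall x, ~~ e x x) /\ (forall x y, e x y = e y x).

Definition bipartite (V : finType) (e : rel V) : Prop :=
  exists c : V -> bool, forall x y, e x y -> c x != c y.

(* Host graphs on the n-vertex set 'I_n, given by their (symmetric) adjacency set. *)
Definition simpleb n (G : {set 'I_n * 'I_n}) : bool :=
  [forall x, (x, x) \notin G] && [forall x, forall y, ((x, y) \in G) == ((y, x) \in G)].

Definition nedges n (G : {set 'I_n * 'I_n}) : nat :=
  #|[set p : 'I_n * 'I_n | (nat_of_ord p.1 < nat_of_ord p.2)%N & p \in G]|.

Definition contains n (G : {set 'I_n * 'I_n}) (V : finType) (e : rel V) : bool :=
  [exists f : {ffun V -> 'I_n},
     injectiveb f && [forall x, forall y, e x y ==> ((f x, f y) \in G)]].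

Definition ex (n : nat) (V : finType) (e : rel V) : nat :=
  \max_(G : {set 'I_n * 'I_n} | simpleb G && ~~ contains G e) nedges G.

(* 1-subdivision sub(F): vertices V plus one new vertex per edge {x,y} of F *)
Definition is_edge (V : finType) (e : rel V) (E : {set V}) : bool :=
  [exists x, exists y, e x y && (E == [set x; y])].

Definition sub_vertex (V : finType) (e : rel V) : finType :=
  (V + {E : {set V} | is_edge e E})%type.

Definition sub_rel (V : finType) (e : rel V) : rel (sub_vertex e) :=
  fun a b => match a, b with
             | inl v, inr E => v \in val E
             | inr E, inl v => v \in val E
             | _, _ => false
             end.

Local Open Scope R_scope.
Arguments sub_rel {V} e _ _.

Definition bigO (f g : nat -> R) : Prop :=
  exists (C : R) (N : nat), forall n, (N <= n)%coq_nat -> f n <= C * g n.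

Definition bigTheta (f g : nat -> R) : Prop :=
  exists (c C : R) (N : nat), 0 < c /\
    forall n, (N <= n)%coq_nat -> c * g n <= f n /\ f n <= C * g n.

(* Main.v *)
Require Import Defs.
From Stdlib Require Import Reals ZArith QArith Qreals Lra.
From HB Require Import structures.
From mathcomp Require Import all_boot all_algebra finfield zify.
Set Implicit Arguments. Unset Strict Implicit. Unset Printing Implicit Defensive.
Import GRing.Theory.
Local Open Scope nat_scope.

(**
Write [r = 2 - x].  To a graph [T] with a set of roots is attached the power
[T^p], made of [p] copies of [T] sharing their roots.  Let [x(T)] be the number
of non-root vertices divided by the number of edges.  Adding a root for each
colour class of the non-roots changes [x] into [x / (1 + x)], and subdividing
all edges changes [x] into [(1 + x) / 2].  From a star, where [x = 1], these two
operations reach every rational of [(0, 1]], and both preserve the property that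
[ex(n, T^p) = O(n^(2 - x))] for every [p]: the subdivision by hypothesis, the
other one by looking for [T^p] between the neighbourhoods of two vertices, cut
into pieces of about the average degree.

The matching lower bound for some [p] is algebraic.  Over a field with [q]
elements, join [x] and [y] of [F^b] when the first [a] coordinates of [y] are
given by polynomials [g_t], with coefficient vector [t], in the other
coordinates of [x] and [y].  Take [K] disjoint copies of [T] with the same
roots in this graph.  Each edge imposes [a] linear conditions on [t], so [t]
and the whole configuration depend on at most [dim t + b |roots|] parameters.
If [K > b |roots|], then [t] and a coordinate [y_i] of one vertex in each copy
satisfy a nontrivial relation [Phi(t, y_1, ..., y_K) = 0], of degree bounded
independently of [q].  For [t] with [Phi(t, _) <> 0], a coordinate can only take
boundedly many values on the copies of [T] over given roots, so that [T^p] is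
not contained in the graph for large [p].
*)

(** * Embeddings and the extremal function *)

Definition embeds (V W : finType) (e : rel V) (g : rel W) : Prop :=
  exists f : V -> W, injective f /\ forall x y, e x y -> g (f x) (f y).

Lemma containsP n (G : {set 'I_n * 'I_n}) (V : finType) (e : rel V) :
  reflect (embeds e (fun x y => (x, y) \in G)) (contains G e).
Proof.
apply: (iffP existsP) => [[f /andP[/injectiveP fI /forallP fe]]|[f [fI fe]]].
  by exists f; split=> // x y; move/(_ x)/forallP/(_ y)/implyP: fe; apply.
exists (finfun f); apply/andP; split.
  by apply/injectiveP => x y; rewrite !ffunE => /fI.
by apply/forallP => x; apply/forallP => y; apply/implyP => /fe; rewrite !ffunE.
Qed.

Lemma ex_embeds (V W : finType) (e : rel V) (e' : rel W) n :
  embeds e e' -> ex n e <= ex n e'.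
Proof.
move=> [h [hI he]]; apply/bigmax_leqP => G /andP[sG nG].
apply: (@leq_bigmax_cond _ _ (@nedges n) G); rewrite sG; apply: contra nG.
move/containsP=> [f [fI fe]]; apply/containsP; exists (f \o h); split.
  exact: inj_comp.
by move=> x y /he /fe.
Qed.

Lemma nedges_double n (G : {set 'I_n * 'I_n}) : simpleb G -> #|G| = 2 * nedges G.
Proof.
move=> /andP[/forallP irr /forallP symG].
have sG x y : ((x, y) \in G) = ((y, x) \in G).
  by move/forallP/(_ y)/eqP: (symG x).
rewrite /nedges; set A := [set p | _].
pose sw (p : 'I_n * 'I_n) := (p.2, p.1).
have swI : injective sw by move=> [a b] [c d] [-> ->].
have -> : G = A :|: sw @: A.
  apply/setP => [[x y]]; rewrite !inE /=.
  have -> : ((x, y) \in sw @: A) = (y < x)%N && ((x, y) \in G).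
    apply/imsetP/idP => [[[a b]]|/andP[l h]].
      by rewrite inE /= => /andP[l h] [-> ->]; rewrite l sG.
    by exists (y, x); rewrite // inE /= l sG.
  case: (ltngtP x y) => //= [_|E]; first by rewrite orbF.
  by apply: negbTE; have -> : x = y by apply: val_inj.
rewrite cardsU card_imset //.
have -> : A :&: sw @: A = set0.
  apply/setP => [[x y]]; rewrite !inE; apply/negP => /andP[/andP[/= l _]].
  by case/imsetP=> [[a b]]; rewrite inE /= => /andP[l' _] [E1 E2]; subst; lia.
by rewrite cards0 subn0 mul2n addnn.
Qed.

(* Isolated vertices of [e] are excluded because they could land outside [S]. *)
Lemma card_rel_le_ex (V W : finType) (e : rel V) (g : rel W) (S : {set W}) m :
  (forall x, exists y, e x y || e y x) ->
  irreflexive g -> symmetric g ->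
  (forall x y, g x y -> x \in S) -> #|S| <= m -> ~ embeds e g ->
  #|[set p : W * W | g p.1 p.2]| <= 2 * ex m e.
Proof.
move=> noniso girr gsym gS Sm ng.
set A := [set p | _].
have [->|[[a b]]] := set_0Vmem A; first by rewrite cards0.
rewrite inE /= => gab.
case: m Sm => [|m] Sm.
  by move: (gS _ _ gab); rewrite (cards0_eq (_ : #|S| = 0)) ?inE //; lia.
(* [i] numbers the elements of [S]; off [S] its values are arbitrary, so it is injective on [S]
   only. *)
pose i x : 'I_m.+1 := inord (index x (enum S)).
have iv x : x \in S -> i x = index x (enum S) :> nat.
  move=> xS; rewrite inordK //; apply: leq_trans Sm.
  by move: xS; rewrite -mem_enum -index_mem -cardE.
have iI : {in S &, injective i}.
  move=> x y xS yS /(congr1 val) /=; rewrite !iv // => E.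
  have : nth a (enum S) (index x (enum S)) = nth a (enum S) (index y (enum S)) by rewrite E.
  by rewrite !nth_index ?mem_enum.
have gS2 x y : g x y -> y \in S by rewrite gsym; apply: gS.
pose G := [set (i p.1, i p.2) | p in A].
have mG x y : reflect (exists u v, [/\ g u v, x = i u & y = i v]) ((x, y) \in G).
  apply: (iffP imsetP) => [[[u v]]|[u [v [guv -> ->]]]].
    by rewrite inE /= => guv [-> ->]; exists u, v.
  by exists (u, v); rewrite ?inE.
have sG : simpleb G.
  apply/andP; split.
    apply/forallP => x; apply/negP => /mG[u [v [guv xu xv]]].
    have uv : u = v by apply: iI; rewrite -?xu -?xv //; [apply: gS guv|apply: gS2 guv].
    by move: guv; rewrite uv girr.
  apply/forallP => x; apply/forallP => y; apply/eqP.
  by apply/mG/mG => -[u [v [guv -> ->]]]; exists v, u; rewrite gsym.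
have nG : ~~ contains G e.
  apply/negP => /containsP[f [fI fe]]; apply: ng.
  have /fin_all_exists[h hP] : forall x, exists u, u \in S /\ f x = i u.
    move=> x; have [y /orP[]/fe/mG[u [v [guv E1 E2]]]] := noniso x.
      by exists u; split=> //; apply: gS guv.
    by exists v; split=> //; apply: gS2 guv.
  exists h; split.
    move=> x y Exy; apply: fI; have [_ ->] := hP x; have [_ ->] := hP y.
    by rewrite Exy.
  move=> x y /fe/mG[u [v [guv E1 E2]]].
  have [xS fx] := hP x; have [yS fy] := hP y.
  have <- : u = h x by apply: iI => //; [apply: gS guv|rewrite -E1 fx].
  by have <- : v = h y by apply: iI => //; [apply: gS2 guv|rewrite -E2 fy].
have -> : #|A| = #|G|.
  rewrite card_in_imset // => -[x y] [u v]; rewrite !inE /= => gxy guv [E1 E2].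
  by congr pair; apply: iI => //; [apply: gS gxy|apply: gS guv|apply: gS2 gxy|apply: gS2 guv].
rewrite (nedges_double sG) leq_mul2l /=.
by apply: (@leq_bigmax_cond _ _ (@nedges m.+1) G); rewrite sG.
Qed.

(** * Rooted graphs and their powers *)

(* The [outer] vertices are the roots; [rconn] says that the inner vertices lie
   in one connected component. *)
Record rooted_graph := RootedGraph {
  inner : finType;
  outer : finType;
  einner : rel inner;
  eouter : inner -> outer -> bool;
  cinner : inner -> bool;
  couter : outer -> bool;
  einner_sym : symmetric einner;
  einner_col : forall u v, einner u v -> cinner u != cinner v;
  eouter_col : forall u r, eouter u r -> cinner u != couter r;
  rconn : forall (f : inner -> bool) (g : outer -> bool),
    (forall u v, einner u v -> f u = f v) ->
    (forall u r, eouter u r -> f u = g r) -> forall u v, f u = f v;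
  noniso_inner : forall u, (exists v, einner u v) \/ (exists r, eouter u r);
  noniso_outer : forall r, exists u, eouter u r;
  outer_edge : exists u r, eouter u r
}.

Definition pow_vertex (T : rooted_graph) p : finType := (outer T + inner T * 'I_p)%type.

Definition pow_rel (T : rooted_graph) p : rel (pow_vertex T p) := fun x y =>
  match x, y with
  | inl _, inl _ => false
  | inl r, inr (u, _) => eouter u r
  | inr (u, _), inl r => eouter u r
  | inr (u, i), inr (v, j) => (i == j) && einner u v
  end.
Arguments pow_rel T p : clear implicits.

Definition pow_col (T : rooted_graph) p (x : pow_vertex T p) : bool :=
  match x with inl r => couter r | inr (u, _) => cinner u end.

Lemma pow_rel_col T p x y : pow_rel T p x y -> pow_col x != pow_col y.
Proof.
case: x y => [r|[u i]] [r'|[v j]] //=.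
- by move/eouter_col; rewrite eq_sym.
- by move/eouter_col.
- by case/andP=> _ /einner_col.
Qed.

Lemma pow_rel_sym T p : symmetric (pow_rel T p).
Proof. by case=> [r|[u i]] [r'|[v j]] //=; rewrite eq_sym einner_sym. Qed.

Lemma pow_simple T p : simple_graph (pow_rel T p).
Proof.
split; last exact: pow_rel_sym.
by move=> x; apply/negP => /pow_rel_col; rewrite eqxx.
Qed.

Lemma pow_bipartite T p : bipartite (pow_rel T p).
Proof. by exists (@pow_col T p); apply: pow_rel_col. Qed.

Lemma pow_noniso T p x : 0 < p -> exists y, pow_rel T p x y || pow_rel T p y x.
Proof.
move=> p0; case: x => [r|[u i]].
  by have [u ur] := noniso_outer r; exists (inr (u, Ordinal p0)); rewrite /= ur.
case: (noniso_inner u) => [[v uv]|[r ur]]; first by exists (inr (v, i)); rewrite /= eqxx uv.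
by exists (inl r); rewrite /= ur.
Qed.

(** Modulo 2, the sum of [c] and [pow_col] is constant along edges. By [rconn] it is constant on the
    inner vertices of a copy, and the shared root [r0] carries its value from one copy to the
    next. *)
Lemma pow_col_rigid T p (c : pow_vertex T p -> bool) :
  (forall x y, pow_rel T p x y -> c x != c y) ->
  exists b, forall u i, c (inr (u, i)) = b (+) cinner u.
Proof.
move=> cP; have [u0 [r0 ur0]] := outer_edge T.
pose d x := c x (+) pow_col x.
have dP x y : pow_rel T p x y -> d x = d y.
  by move=> xy; move: (cP _ _ xy) (pow_rel_col xy); rewrite /d; case: (c x); case: (c y); case: (pow_col x); case: (pow_col y).
exists (d (inl r0)) => u i.
have -> : d (inl r0) = d (inr (u, i)).
  rewrite (dP (inl r0) (inr (u0, i))) //.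
  apply: (@rconn T (fun u => d (inr (u, i))) (fun r => d (inl r))) => [v w vw|v r vr]; apply: dP => //=.
  by rewrite eqxx.
by rewrite /d /= addbK.
Qed.

(* Inner edges are oriented from colour [false] to colour [true], so that every
   edge is counted once. *)
Definition edgeb (T : rooted_graph) (q : inner T * (inner T + outer T)) : bool :=
  match q.2 with
  | inl v => einner q.1 v && ~~ cinner q.1
  | inr r => eouter q.1 r
  end.

Definition edge (T : rooted_graph) : finType := {q | @edgeb T q}.

(* The star, cones and subdivisions *)
#[local] Obligation Tactic := idtac.

(** Its power is the star with [p] leaves, centred at the root: the case [x = 1]. *)
Program Definition rstar : rooted_graph := @RootedGraph unit unit
  (fun _ _ => false) (fun _ _ => true) (fun _ => false) (fun _ => true)
  _ _ _ _ _ _ _.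
Next Obligation. by []. Qed.
Next Obligation. by []. Qed.
Next Obligation. by []. Qed.
Next Obligation. by move=> f g _ _ [] []. Qed.
Next Obligation. by right; exists tt. Qed.
Next Obligation. by exists tt. Qed.
Next Obligation. by exists tt, tt. Qed.

Lemma card_edge_rstar : 0 < #|edge rstar|.
Proof. by apply/card_gt0P; exists (exist _ (tt, inr tt) isT). Qed.

Section Cone.
Variable T : rooted_graph.

(** A colour gets an apex only if some inner vertex has it: otherwise the apex would be isolated,
    against [noniso_outer]. *)
Definition cone_outer : finType := (outer T + {b : bool | [exists u : inner T, cinner u == b]})%type.
Definition cone_eouter (u : inner T) (r : cone_outer) : bool :=
  match r with inl r => eouter u r | inr b => cinner u == val b end.
Definition cone_couter (r : cone_outer) : bool :=
  match r with inl r => couter r | inr b => ~~ val b end.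

Program Definition cone : rooted_graph := @RootedGraph (inner T) cone_outer
  (@einner T) cone_eouter (@cinner T) cone_couter _ _ _ _ _ _ _.
Next Obligation. exact: einner_sym. Qed.
Next Obligation. exact: einner_col. Qed.
Next Obligation.
move=> u [r|b] /=; first exact: eouter_col.
by move/eqP->; case: (val b).
Qed.
Next Obligation.
move=> f g fP gP; apply: (@rconn T f (g \o inl)) => // w r wr; exact: gP.
Qed.
Next Obligation.
by move=> u; case: (noniso_inner u) => [|[r ur]]; [left|right; exists (inl r)].
Qed.
Next Obligation.
case=> [r|[b /= /existsP[u ub]]]; last by exists u.
by have [u ur] := noniso_outer r; exists u.
Qed.
Next Obligation.
by have [u [r ur]] := outer_edge T; exists u, (inl r).
Qed.

(** Each inner vertex gains the edge to the apex of its colour, so [1 / x] grows by at least 1. *)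
Lemma card_edge_cone : #|edge T| + #|inner T| <= #|edge cone|.
Proof.
have h1 (q : edge T) : edgeb (T := cone)
    ((val q).1, match (val q).2 with inl v => inl v | inr r => inr (inl r) end).
  by case: q => [[u [v|r]]].
have h2 (u : inner T) : [exists v : inner T, cinner v == cinner u] by apply/existsP; exists u.
have h3 (u : inner T) : edgeb (T := cone) (u, inr (inr (exist _ (cinner u) (h2 u)))).
  by rewrite /edgeb /=.
pose h (x : edge T + inner T) : edge cone :=
  match x with inl q => Sub _ (h1 q) | inr u => Sub _ (h3 u) end.
rewrite -card_sum; apply: (@leq_card _ _ h).
case=> [[[u [v|r]] e1]|u] [[[u' [v'|r']] e2]|u'] //= /(congr1 val) //=.
- by case=> E1 E2; congr inl; apply: val_inj; rewrite /= E1 E2.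
- by case=> E1 E2; congr inl; apply: val_inj; rewrite /= E1 E2.
- by case=> ->.
Qed.

End Cone.

Section Subdivision.
Variable T : rooted_graph.

(** Midpoints are inner even on edges that end at a root, so that a power copies them while the
    roots stay shared. *)
Definition rsub_inner : finType := (inner T + edge T)%type.
Definition incident (u : inner T) (q : edge T) : bool :=
  (u == (val q).1) || (inl u == (val q).2).
Definition rsub_einner : rel rsub_inner := fun x y =>
  match x, y with
  | inl u, inr q => incident u q
  | inr q, inl u => incident u q
  | _, _ => false
  end.
Definition rsub_eouter (x : rsub_inner) (r : outer T) : bool :=
  match x with inl _ => false | inr q => (val q).2 == inr r end.
Definition rsub_cinner (x : rsub_inner) : bool := if x is inr _ then true else false.

Lemma incident_einner (f : rsub_inner -> bool) :
  (forall x y, rsub_einner x y -> f x = f y) ->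
  forall u v, einner u v -> f (inl u) = f (inl v).
Proof.
move=> fP; have main u v : einner u v -> ~~ cinner u -> f (inl u) = f (inl v).
  move=> uv cu; have h : @edgeb T (u, inl v) by rewrite /edgeb /= uv.
  rewrite (fP _ (inr (Sub _ h))) /= /incident /= ?eqxx //.
  by apply: fP; rewrite /= /incident /= eqxx orbT.
move=> u v uv; case: (boolP (cinner u)) => cu; last exact: main.
by symmetry; apply: main; rewrite ?[einner v u]einner_sym //; move: (einner_col uv); rewrite cu; case: cinner.
Qed.

Program Definition rsub : rooted_graph := @RootedGraph rsub_inner (outer T)
  rsub_einner rsub_eouter rsub_cinner (fun _ => false) _ _ _ _ _ _ _.
Next Obligation. by case=> [u|q] [v|q']. Qed.
Next Obligation. by move=> [u|q] [v|q']. Qed.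
Next Obligation. by case. Qed.
Next Obligation.
move=> f g fP gP; have fU a b : f (inl a) = f (inl b).
  apply: (rconn (f := fun u => f (inl u)) (g := g)) => [a' b'|a' r ar] /=; first exact: incident_einner.
  have h : @edgeb T (a', inr r) by [].
  rewrite -(gP (inr (Sub _ h)) r) /= ?eqxx //; apply: fP.
  by rewrite /= /incident /= eqxx.
have fE (q : edge T) : f (inr q) = f (inl (val q).1).
  by apply: fP; rewrite /= /incident eqxx.
by move=> [u|q] [v|q']; rewrite ?fE.
Qed.
Next Obligation.
move=> u; left; case: u => [u|q]; last by exists (inl (val q).1); rewrite /= /incident eqxx.
case: (noniso_inner u) => [[v uv]|[r ur]]; last first.
  have h : @edgeb T (u, inr r) by [].
  by exists (inr (Sub _ h)); rewrite /= /incident /= eqxx.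
case: (boolP (cinner u)) => cu.
  have h : @edgeb T (v, inl u).
    by rewrite /edgeb /= einner_sym uv; move: (einner_col uv); rewrite cu; case: cinner.
  by exists (inr (Sub _ h)); rewrite /= /incident /= eqxx orbT.
have h : @edgeb T (u, inl v) by rewrite /edgeb /= uv.
by exists (inr (Sub _ h)); rewrite /= /incident /= eqxx.
Qed.
Next Obligation.
move=> r; have [u ur] := noniso_outer r; have h : @edgeb T (u, inr r) by [].
by exists (inr (Sub _ h)) => /=.
Qed.
Next Obligation.
have [u [r ur]] := outer_edge T; have h : @edgeb T (u, inr r) by [].
by exists (inr (Sub _ h)), r => /=.
Qed.

Lemma card_inner_rsub : #|inner rsub| = #|inner T| + #|edge T|.
Proof. by rewrite -card_sum. Qed.

Lemma card_edge_rsub : 2 * #|edge T| <= #|edge rsub|.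
Proof.
have h1 (q : edge T) : edgeb (T := rsub) (inl (val q).1, inl (inr q)).
  by rewrite /edgeb /= /incident eqxx.
(* [edgeb] imposes the form of the far half: from [v] to the midpoint if the edge ends at an inner
   vertex [v], from the midpoint if it ends at a root. *)
pose far (q : edge T) : inner rsub * (inner rsub + outer rsub) :=
  match (val q).2 with
  | inl v => (inl v, inl (inr q))
  | inr r => (inr q, inr r)
  end.
have h2 (q : edge T) : edgeb (far q).
  case: q => [[u [v|r]] e1]; rewrite /far /edgeb /= ?eqxx //.
  by rewrite /incident /= eqxx orbT.
pose h (x : edge T + edge T) : edge rsub :=
  match x with inl q => Sub _ (h1 q) | inr q => Sub _ (h2 q) end.
rewrite mul2n -addnn -card_sum; apply: (@leq_card _ _ h).
have ne (q : edge T) v : (val q).2 = inl v -> (val q).1 <> v.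
  case: q => [[u [w|r]] e1] //= [<-] E.
  by move: e1; rewrite /edgeb /= E => /andP[/einner_col]; rewrite eqxx.
case=> q [] q' /(congr1 val) /=; rewrite /far.
- by case=> _ ->.
- case E: (val q').2 => [v|r] [] //= E1 E2; subst q'.
  by case: (ne _ _ E E1).
- case E: (val q).2 => [v|r] [] //= E1 E2; subst q'.
  by case: (ne _ _ E (esym E1)).
- by case E: (val q).2 => [v|r]; case E': (val q').2 => [v'|r'] // [] // E1 E2; rewrite ?E1 ?E2.
Qed.

Section EmbedPow.
Variable p : nat.
Let F := pow_rel T p.

Definition near_end (q : edge T) (i : 'I_p) : pow_vertex T p := inr ((val q).1, i).
Definition far_end (q : edge T) (i : 'I_p) : pow_vertex T p :=
  match (val q).2 with inl v => inr (v, i) | inr r => inl r end.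

Lemma pow_rel_ends q i : F (near_end q i) (far_end q i).
Proof.
case: q => [[u [v|r]] e1]; rewrite /F /near_end /far_end /=; last by [].
by move: e1 => /andP[]; rewrite eqxx.
Qed.

Lemma is_edge_ends q i : is_edge F [set near_end q i; far_end q i].
Proof.
apply/existsP; exists (near_end q i); apply/existsP; exists (far_end q i).
by rewrite pow_rel_ends eqxx.
Qed.

(** Two edges cannot be reverses of each other: the near end of an inner edge has colour [false],
    its far end colour [true], and a root is never a near end. *)
Lemma near_end_far_end q i q' i' : near_end q i <> far_end q i /\
  (near_end q i = far_end q' i' -> near_end q' i' <> far_end q i).
Proof.
split=> [E|].
  by move: (pow_rel_col (pow_rel_ends q i)); rewrite -E eqxx.
case: q q' => [[u [v|r]] e1] [[u' [v'|r']] e2] //=; rewrite /near_end /far_end /= => -[E1 E2] // [E3 E4].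
move: e1 e2; rewrite /edgeb /= E1 -E3 => /andP[_ h] /andP[/einner_col].
by rewrite (negbTE h); case: cinner.
Qed.

Lemma ends_inj q i q' i' :
  [set near_end q i; far_end q i] = [set near_end q' i'; far_end q' i'] ->
  q = q' /\ i = i'.
Proof.
move=> E.
have : near_end q i \in [set near_end q' i'; far_end q' i'] by rewrite -E !inE eqxx.
rewrite !inE => /orP[/eqP E1|/eqP E1].
  have : far_end q i \in [set near_end q' i'; far_end q' i'] by rewrite -E !inE eqxx orbT.
  rewrite !inE -E1 => /orP[/eqP E2|/eqP E2].
    by case: (near_end_far_end q i q i) => + _; case; rewrite -E2.
  case: E1 => E1 E3; split=> //; apply: val_inj; move: E1 E2; rewrite /far_end /=.
  case: (sval q) (sval q') => [u [v|r]] [u' [v'|r']] /= -> // [->] //.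
have : near_end q' i' \in [set near_end q i; far_end q i] by rewrite E !inE eqxx.
rewrite !inE => /orP[/eqP E2|/eqP E2].
  by case: (near_end_far_end q' i' q' i') => []; rewrite E2 E1.
by case: (near_end_far_end q i q' i') => _ /(_ E1).
Qed.

(** Subdividing commutes with taking powers: the midpoint of [q] in copy [i] goes to the subdivision
    vertex of that edge of [F], injectively by [ends_inj]. This brings the powers of [rsub] under
    the subdivision hypothesis. *)
Lemma pow_rsub_embeds : embeds (pow_rel rsub p) (sub_rel F).
Proof.
pose h (x : pow_vertex rsub p) : sub_vertex F :=
  match x with
  | inl r => inl (inl r)
  | inr (inl u, i) => inl (inr (u, i))
  | inr (inr q, i) => inr (Sub _ (is_edge_ends q i))
  end.
exists h; split.
  move=> [r|[[u|q] i]] [r'|[[u'|q'] i']] //=.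
  - by case=> ->.
  - by case=> -> ->.
  - by case=> /ends_inj[-> ->].
have inc u q (i : 'I_p) : incident u q -> inr (u, i) \in [set near_end q i; far_end q i].
  rewrite /incident !inE => /orP[/eqP->|/eqP E]; first by rewrite eqxx.
  by rewrite /far_end -E eqxx orbT.
have far (q : edge T) r i : (val q).2 == inr r -> inl r \in [set near_end q i; far_end q i].
  by move/eqP=> E; rewrite !inE /far_end E eqxx orbT.
move=> [r|[[u|q] i]] [r'|[[u'|q'] i']] //=; try exact: far.
- by rewrite andbF.
- by case/andP=> /eqP E; subst i'; apply: inc.
- by case/andP=> /eqP E; subst i'; apply: inc.
- by rewrite andbF.
Qed.

End EmbedPow.
End Subdivision.

(** * Upper bound for cones, by counting paths with three edges *)

Lemma subset_of_card (W : finType) (A : {set W}) k :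
  k <= #|A| -> exists2 B : {set W}, B \subset A & #|B| = k.
Proof.
move=> kA; exists [set x in take k (enum A)].
  by apply/subsetP => x; rewrite inE => /mem_take; rewrite mem_enum.
rewrite cardsE (card_uniqP _) ?take_uniq ?enum_uniq // size_take -cardE.
by case: ltnP => // h; apply/eqP; rewrite eqn_leq h kA.
Qed.

(** Split the colourings into four classes by their values at [x] and [y]; overwriting these two
    values injects each class into the set on the right. *)
Lemma card_fun_split (W : finType) (x y : W) : x != y ->
  #|{ffun W -> bool}| <= 4 * #|[set c : {ffun W -> bool} | ~~ c x & c y]|.
Proof.
move=> xy; set A := [set c : {ffun W -> bool} | _ & _].
pose B b b' := [set c : {ffun W -> bool} | (c x == b) && (c y == b')].
have BA b b' : #|B b b'| <= #|A|.
  pose h (c : {ffun W -> bool}) :=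
    [ffun z => if z == x then false else if z == y then true else c z].
  have hI : {in B b b' &, injective h}.
    move=> c c'; rewrite !inE => /andP[/eqP cx /eqP cy] /andP[/eqP cx' /eqP cy'] /ffunP E.
    apply/ffunP => z; move: (E z); rewrite !ffunE.
    by case: (eqVneq z x) => [->|_]; [rewrite cx cx'|case: (eqVneq z y) => [->|_] //; rewrite cy cy'].
  rewrite -(card_in_imset hI); apply: subset_leq_card.
  apply/subsetP => _ /imsetP[c _ ->]; rewrite !inE !ffunE eqxx eqxx.
  by rewrite eq_sym (negbTE xy).
have -> : #|{ffun W -> bool}| = #|B true true :|: B true false :|: (B false true :|: B false false)|.
  by rewrite -cardsT; congr #|pred_of_set _|; apply/setP => c; rewrite !inE; case: (c x); case: (c y).
rewrite (leq_trans (leq_card_setU _ _)) // -[4]/(2 + 2) mulnDl leq_add //;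
by rewrite (leq_trans (leq_card_setU _ _)) // mul2n -addnn leq_add.
Qed.

(** Average over all colourings: each pair of [G] is kept by at least a quarter of them. *)
Lemma half_bipartite n (G : {set 'I_n * 'I_n}) : simpleb G ->
  exists c : 'I_n -> bool,
    #|G| <= 4 * #|[set q in G | ~~ c q.1 & c q.2]|.
Proof.
move=> /andP[/forallP irr _].
pose H (c : {ffun 'I_n -> bool}) := [set q in G | ~~ c q.1 & c q.2].
case: (boolP [exists c, #|G| <= 4 * #|H c|]) => [/existsP[c h]|]; first by exists c.
rewrite negb_exists => /forallP h.
pose F := #|{ffun 'I_n -> bool}|.
have F0 : 0 < F by apply/card_gt0P; exists [ffun=> true].
have sumH : \sum_c 4 * #|H c| >= #|G| * F.
  rewrite -big_distrr /=.
  have -> : \sum_c #|H c| = \sum_(q in G) #|[set c : {ffun 'I_n -> bool} | ~~ c q.1 & c q.2]|.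
    rewrite (eq_bigr (fun c : {ffun 'I_n -> bool} => \sum_(q in G) (~~ c q.1 && c q.2 : nat))); last first.
      by move=> c _; rewrite -sum1_card big_mkcond [RHS]big_mkcond; apply: eq_bigr => q _; rewrite !inE; case: (q \in G); case: (c q.1); case: (c q.2).
    rewrite exchange_big; apply: eq_bigr => q _ /=.
    by rewrite -sum1_card [RHS]big_mkcond; apply: eq_bigr => c _; rewrite !inE; case: (c q.1); case: (c q.2).
  rewrite big_distrr /= -sum_nat_const; apply: leq_sum => -[x y] xyG /=.
  by apply: card_fun_split; apply: contraTneq xyG => ->; apply: irr.
have : \sum_c (4 * #|H c|).+1 <= \sum_(c : {ffun 'I_n -> bool}) #|G|.
  by apply: leq_sum => c _; rewrite ltnNge h.
rewrite sum_nat_const; under eq_bigr do rewrite -addn1.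
rewrite big_split /= sum_nat_const muln1 => /(leq_trans (leq_add sumH (leqnn _))).
by rewrite mulnC -[X in _ <= X]addn0 leq_add2l leqn0 => /eqP E; rewrite /F E in F0.
Qed.

(** Removing [s] elements at a time cuts [A] into at most [(k %/ s).+1] pieces of size at most
    [s]. *)
Lemma subadditive_chunks (W : finType) (f : {set W} -> nat) s M :
  0 < s -> (forall A B, f (A :|: B) <= f A + f B) ->
  (forall A : {set W}, #|A| <= s -> f A <= M) ->
  forall (A : {set W}) k, #|A| <= k -> f A <= (k %/ s).+1 * M.
Proof.
move=> s0 fU fM A k; elim/ltn_ind: k A => k IH A Ak.
case: (leqP k s) => ks.
  by apply: leq_trans (fM _ (leq_trans Ak ks)) _; rewrite leq_pmull.
have [As|As] := leqP #|A| s.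
  by apply: leq_trans (fM _ As) _; rewrite leq_pmull.
have [B BA Bs] := subset_of_card (ltnW As).
have -> : A = B :|: (A :\: B).
  by apply/setP => x; rewrite !inE; case: (boolP (x \in B)) => // /(subsetP BA).
apply: leq_trans (fU _ _) _.
have -> : k = (k - s) + 1 * s by lia.
rewrite divnDMl // addn1 mulSn leq_add ?fM ?Bs //.
apply: IH; first lia.
by rewrite cardsD (setIidPr BA) Bs leq_sub2r.
Qed.

Lemma card_pairs (V W : finType) (B : {set V * W}) :
  #|B| = \sum_x #|[set y | (x, y) \in B]| /\ #|B| = \sum_y #|[set x | (x, y) \in B]|.
Proof.
have E : #|B| = \sum_x \sum_y ((x, y) \in B : nat).
  rewrite -sum1_card big_mkcond pair_bigA /=.
  by apply: eq_bigr => -[x y] _ /=; case: (_ \in _).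
split; rewrite E; last rewrite exchange_big /=; apply: eq_bigr => x _;
  by rewrite -sum1_card [RHS]big_mkcond; apply: eq_bigr => y _; rewrite inE; case: (_ \in _).
Qed.

Section ConeBound.
Variables (T : rooted_graph) (p n s : nat).
Hypotheses (p_gt0 : 0 < p) (s_gt0 : 0 < s).
Let F := pow_rel T p.
Variable G : {set 'I_n * 'I_n}.
Hypotheses (sG : simpleb G) (nG : ~~ contains G (pow_rel (cone T) p)).
Variables (c : 'I_n -> bool) (H : {set 'I_n * 'I_n}).
Hypothesis HP : forall x y, (x, y) \in H -> [/\ (x, y) \in G, ~~ c x & c y].

Let N1 x := [set y | (x, y) \in H].
Let N2 y := [set x | (x, y) \in H].
Let eb (X Y : {set 'I_n}) := #|[set q in H | (q.1 \in X) && (q.2 \in Y)]|.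

Let symG x y : (x, y) \in G -> (y, x) \in G.
Proof. by case/andP: sG => _ /forallP/(_ x)/forallP/(_ y)/eqP->. Qed.

(** [a] is joined to all of [X] and [b] to all of [Y], so a copy of [T^p] between [X] and [Y] would
    extend, with apexes [a] and [b], to the power of the cone. *)
Lemma eb_small a b (X Y : {set 'I_n}) : X \subset N2 a :\ b -> Y \subset N1 b :\ a ->
  #|X| <= s -> #|Y| <= s -> eb X Y <= ex (2 * s) F.
Proof.
move=> /subsetP Xa /subsetP Yb Xs Ys; rewrite /eb; set B := [set q in H | _].
pose g x y := ((x, y) \in B) || ((y, x) \in B).
have BP x y : (x, y) \in B -> [/\ (x, y) \in G, ~~ c x, c y, x \in X & y \in Y].
  by rewrite inE => /andP[/HP[? ? ?] /andP[? ?]].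
have gc x y : g x y -> c x != c y.
  by case/orP=> /BP[_ /negbTE-> -> _ _].
have gS x y : g x y -> x \in X :|: Y.
  by case/orP=> /BP[_ _ _ ? ?]; rewrite inE; apply/orP; [left|right].
have gsym : symmetric g by move=> x y; rewrite /g orbC.
have gG x y : g x y -> (x, y) \in G by case/orP=> /BP[? _ _ _ _] //; apply: symG.
(* [H] keeps one orientation of each edge, while [card_rel_le_ex] counts both. *)
have B2 : 2 * #|B| <= #|[set q | g q.1 q.2]|.
  pose sw (q : 'I_n * 'I_n) := (q.2, q.1).
  have swI : injective sw by move=> [x y] [x' y'] [-> ->].
  have -> : 2 * #|B| = #|B :|: sw @: B|.
    rewrite cardsU card_imset // mul2n -addnn (_ : _ :&: _ = set0) ?cards0 ?subn0 //.
    apply/setP => -[x y]; rewrite in_set0; apply/negP; rewrite in_setI => /andP[/BP[_ cx _ _ _]].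
    by case/imsetP=> -[x' y'] /BP[_ _ cy _ _] [E _]; rewrite E cy in cx.
  apply: subset_leq_card; apply/subsetP => -[x y]; rewrite in_setU [in X in _ -> X]inE /g /=.
  by case/orP=> [->//|/imsetP[[x' y'] xy [-> ->]]]; rewrite xy orbT.
rewrite -(leq_pmul2l (m := 2)) //; apply: leq_trans B2 _.
apply: (@card_rel_le_ex _ _ F g (X :|: Y)) => //.
- by move=> x; apply: pow_noniso.
- by move=> x; apply/negP => /gc; rewrite eqxx.
- by rewrite (leq_trans (leq_card_setU _ _)) // mul2n -addnn leq_add.
move=> [f [fI fe]]; case/negP: nG; apply/containsP.
(* By rigidity all copies lie the same way round, so one apex serves every inner vertex of a given
   colour. *)
have [beta fb] : exists be, forall u i, c (f (inr (u, i))) = be (+) cinner u.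
  by apply: (@pow_col_rigid T p (c \o f)) => x y /fe/gc.
have fS x : f x \in X :|: Y.
  have [y /orP[]/fe] := pow_noniso x p_gt0; first exact: gS.
  by rewrite gsym; apply: gS.
have Xc x : x \in X -> [/\ ~~ c x, c a, (x, a) \in G & x != b].
  by move/Xa; rewrite !inE => /andP[xb /HP[? ? ?]].
have Yc y : y \in Y -> [/\ c y, ~~ c b, (b, y) \in G & y != a].
  by move/Yb; rewrite !inE => /andP[yb /HP[? ? ?]].
(* The colour of [a] is known from an element of [X], that of [b] from one of [Y]; an edge of the
   copy provides both. *)
have [ca cb] : c a /\ ~~ c b.
  have [u [r ur]] := outer_edge T.
  have /fe/orP[] : F (inr (u, Ordinal p_gt0)) (inl r) by [].
    by case/BP=> _ _ _ /Xc[_ ? _ _] /Yc[].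
  by case/BP=> _ _ _ /Xc[_ ? _ _] /Yc[].
have aS : a \notin X :|: Y.
  by rewrite inE negb_or; apply/andP; split; [apply/negP => /Xc[]|apply/negP => /Yc[_ _ _]]; rewrite ?ca ?eqxx.
have bS : b \notin X :|: Y.
  by rewrite inE negb_or; apply/andP; split; [apply/negP => /Xc[_ _ _]|apply/negP => /Yc[]]; rewrite ?(negbTE cb) ?eqxx.
have ab : a != b by apply: contraTneq ca => ->.
pose apex (x : bool) := if beta (+) x then b else a.
have apexS x : apex x \notin X :|: Y by rewrite /apex; case: ifP.
have apexI : injective apex.
  rewrite /apex => -[] [] //; case: (beta) => //= E; by move: ab; rewrite E eqxx.
pose f' (x : pow_vertex (cone T) p) : 'I_n :=
  match x with
  | inl (inl r) => f (inl r)
  | inl (inr z) => apex (val z)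
  | inr q => f (inr q)
  end.
exists f'; split.
  have apexf z x : apex z = f x -> False by move=> E; move: (apexS z); rewrite E fS.
  move=> [[r|z]|q] [[r'|z']|q'] //=.
  - by move/fI => [->].
  - by move/esym/apexf.
  - by move/fI.
  - by move/apexf.
  - by move/apexI/val_inj->.
  - by move/apexf.
  - by move/fI.
  - by move/esym/apexf.
  - by move/fI => [->].
have apexP u i z : cinner u = z -> (f (inr (u, i)), apex z) \in G.
  move=> uz; have := fS (inr (u, i)); rewrite inE /apex -uz -(fb u i) => /orP[/Xc|/Yc].
    by case=> /negbTE-> _ ? _.
  by case=> -> _ /symG ? _.
move=> [[r|z]|[u i]] [[r'|z']|[u' i']] //= e1.
- by apply: gG; apply: fe.
- by apply: symG; apply: apexP; apply/eqP.
- by apply: gG; apply: fe.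
- by apply: apexP; apply/eqP.
- by apply: gG; apply: fe.
Qed.

Lemma eb_large a b : eb (N2 a :\ b) (N1 b :\ a) <=
  (#|N2 a| %/ s).+1 * ((#|N1 b| %/ s).+1 * ex (2 * s) F).
Proof.
pose f X Y := eb (X :&: (N2 a :\ b)) (Y :&: (N1 b :\ a)).
have fU1 Y X X' : f (X :|: X') Y <= f X Y + f X' Y.
  apply: leq_trans (leq_card_setU _ _); apply: subset_leq_card.
  apply/subsetP => q; rewrite !inE; case: (q \in H) => //=.
  by case: (q.1 \in X); case: (q.1 \in X'); rewrite /= ?orbF => // ->; rewrite ?orbT.
have fU2 X Y Y' : f X (Y :|: Y') <= f X Y + f X Y'.
  apply: leq_trans (leq_card_setU _ _); apply: subset_leq_card.
  apply/subsetP => q; rewrite !inE; case: (q \in H) => //=.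
  by case: (q.2 \in Y); case: (q.2 \in Y'); rewrite /= ?andbF ?orbF => // ->; rewrite ?orbT.
have -> : eb (N2 a :\ b) (N1 b :\ a) = f (N2 a :\ b) (N1 b :\ a).
  by rewrite /f !setIid.
apply: (subadditive_chunks s_gt0 (fU1 _)) => [X Xs|]; last first.
  by apply: subset_leq_card; apply: subD1set.
apply: (subadditive_chunks s_gt0 (fU2 _)) => [Y Ys|]; last first.
  by apply: subset_leq_card; apply: subD1set.
apply: (@eb_small a b); rewrite ?subsetIr //.
  by apply: leq_trans Xs; apply: subset_leq_card; apply: subsetIl.
by apply: leq_trans Ys; apply: subset_leq_card; apply: subsetIl.
Qed.

(** Both sides count the paths [a, x, y, b] with edges in [H]: by the middle edge on the left, by
    the ends on the right. *)
Lemma path3_count :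
  \sum_(q in H) #|N1 q.1 :\ q.2| * #|N2 q.2 :\ q.1| =
  \sum_a \sum_b eb (N2 a :\ b) (N1 b :\ a).
Proof.
transitivity (\sum_(q in H) \sum_a \sum_b ((a \in N1 q.1 :\ q.2) && (b \in N2 q.2 :\ q.1) : nat)).
  apply: eq_bigr => q _; rewrite -!sum1_card big_distrl /= big_mkcond; apply: eq_bigr => a _.
  case: (a \in _); last by rewrite big1.
  by rewrite mul1n big_mkcond; apply: eq_bigr => b _ /=; case: (b \in _).
rewrite exchange_big; apply: eq_bigr => a _; rewrite exchange_big; apply: eq_bigr => b _ /=.
rewrite /eb -sum1_card big_mkcond [RHS]big_mkcond; apply: eq_bigr => -[x y] _ /=.
rewrite !inE /=; case: ((x, y) \in H) => //=.
rewrite [y == a]eq_sym [x == b]eq_sym.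
by case: (a == y); case: (b == x); case: ((x, a) \in H); case: ((b, y) \in H).
Qed.

(** Of the [4 * n * s] edges, at most [2 * n * s] have an end of degree at most [s]; each other edge
    is the middle of at least [s * s] paths. From above, the neighbourhoods on each side are cut
    into at most [5 * n] pieces in all. *)
Lemma path3_bound : #|H| = 4 * n * s -> 0 < n -> 2 * s ^ 3 <= 25 * n * ex (2 * s) F.
Proof.
move=> Hs n0.
have [E1 E2] := card_pairs H.
have S1 : \sum_b (#|N1 b| %/ s).+1 <= 5 * n.
  under eq_bigr do rewrite -addn1; rewrite big_split /= sum_nat_const muln1 card_ord.
  have : s * (\sum_b #|N1 b| %/ s) <= #|H|.
    by rewrite E1 big_distrr /=; apply: leq_sum => b _; rewrite mulnC leq_divM.
  by rewrite Hs [4 * n * s]mulnC leq_pmul2l // -(leq_add2r n) -mulSnr.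
have S2 : \sum_b (#|N2 b| %/ s).+1 <= 5 * n.
  under eq_bigr do rewrite -addn1; rewrite big_split /= sum_nat_const muln1 card_ord.
  have : s * (\sum_b #|N2 b| %/ s) <= #|H|.
    by rewrite E2 big_distrr /=; apply: leq_sum => b _; rewrite mulnC leq_divM.
  by rewrite Hs [4 * n * s]mulnC leq_pmul2l // -(leq_add2r n) -mulSnr.
have up : \sum_a \sum_b eb (N2 a :\ b) (N1 b :\ a) <= (5 * n) * ((5 * n) * ex (2 * s) F).
  apply: leq_trans (leq_sum _ (fun a _ => leq_sum _ (fun b _ => eb_large a b))) _.
  under eq_bigr do rewrite -big_distrr /= -big_distrl /=.
  by rewrite -big_distrl /= leq_mul // leq_mul.
pose bad1 := [set q in H | #|N1 q.1| <= s].
pose bad2 := [set q in H | #|N2 q.2| <= s].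
pose good := [set q in H | (s < #|N1 q.1|) && (s < #|N2 q.2|)].
have ns : n * s = \sum_(x < n) s by rewrite sum_nat_const card_ord.
have b1 : #|bad1| <= n * s.
  have [-> _] := card_pairs bad1; rewrite ns; apply: leq_sum => x _.
  have [h|h] := leqP #|N1 x| s.
    by apply: leq_trans h; apply: subset_leq_card; apply/subsetP => y; rewrite !inE => /andP[].
  by rewrite (_ : [set _ | _] = set0) ?cards0 //; apply/setP => y; rewrite !inE /= leqNgt h andbF.
have b2 : #|bad2| <= n * s.
  have [_ ->] := card_pairs bad2; rewrite ns; apply: leq_sum => x _.
  have [h|h] := leqP #|N2 x| s.
    by apply: leq_trans h; apply: subset_leq_card; apply/subsetP => y; rewrite !inE => /andP[].
  by rewrite (_ : [set _ | _] = set0) ?cards0 //; apply/setP => y; rewrite !inE /= leqNgt h andbF.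
have HU : #|H| <= #|good| + (#|bad1| + #|bad2|).
  apply: leq_trans (leq_add (leqnn _) (leq_card_setU _ _)).
  apply: leq_trans (leq_card_setU _ _); apply: subset_leq_card.
  by apply/subsetP => q qH; rewrite !inE qH /=; do 2 case: leqP => _.
have lo : #|good| * (s * s) <= \sum_(q in H) #|N1 q.1 :\ q.2| * #|N2 q.2 :\ q.1|.
  rewrite -sum_nat_const [leqRHS](big_setID good) /= (setIidPr _); last first.
    by apply/subsetP => q; rewrite inE => /andP[].
  apply: leq_trans (leq_addr _ _); apply: leq_sum => -[x y].
  rewrite inE /= => /and3P[xyH h1 h2].
  move: h1 h2; rewrite (cardsD1 y (N1 x)) (cardsD1 x (N2 y)) !inE xyH !add1n !ltnS.
  exact: leq_mul.
have := leq_trans lo; rewrite path3_count => /(_ _ up).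
rewrite Hs in HU.
move: (ex (2 * s) F) #|good| #|bad1| #|bad2| b1 b2 HU => e g x y b1 b2 HU le.
have g2 : 2 * n * s <= g.
  by move: HU b1 b2; rewrite -!mulnA; move: (n * s) => k; lia.
have h := leq_trans (leq_mul g2 (leqnn (s * s))) le.
rewrite -(leq_pmul2l n0) !expnS expn0.
have <- : 2 * n * s * (s * s) = n * (2 * (s * (s * (s * 1)))) by lia.
by have <- : 5 * n * (5 * n * e) = n * (25 * n * e) by lia.
Qed.

End ConeBound.

Lemma cone_nedges (T : rooted_graph) p n s (G : {set 'I_n * 'I_n}) :
  0 < p -> 0 < s -> simpleb G -> ~~ contains G (pow_rel (cone T) p) ->
  nedges G <= 8 * n * s \/ 2 * s ^ 3 <= 25 * n * ex (2 * s) (pow_rel T p).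
Proof.
move=> p0 s0 sG nG; have [n0|n0] := posnP n.
  left; rewrite /nedges (leq_trans (max_card _)) // card_prod card_ord n0.
  by rewrite !muln0 mul0n.
have [c] := half_bipartite sG; set H0 := [set q in G | _] => hH.
rewrite (nedges_double sG) in hH.
(* Since [2 * nedges G <= 4 * #|H0|], a smaller [H0] gives the first alternative. *)
have [h|h] := leqP (4 * n * s) #|H0|; last by left; lia.
have [H HH0 Hs] := subset_of_card h; right.
apply: (@path3_bound T p n s p0 s0 G sG nG c H) => // x y /(subsetP HH0).
by rewrite inE => /and3P[].
Qed.

(** * Polynomial functions of bounded degree *)

Section PolyFun.
Local Open Scope ring_scope.
Variables (F : fieldType) (Z : finType).
Implicit Types (g h : (Z -> F) -> F) (k : nat).

(* [k] bounds the degree in each variable separately. *)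
Definition polyfun k g : Prop :=
  exists2 s : seq (F * {ffun Z -> nat}),
    all (fun m : F * {ffun Z -> nat} => [forall i, (m.2 i <= k)%N]) s &
    forall z, g z = \sum_(m <- s) m.1 * \prod_i z i ^+ m.2 i.

Lemma polyfun_ext k g h : g =1 h -> polyfun k g -> polyfun k h.
Proof. by move=> gh [s s1 s2]; exists s => // z; rewrite -gh. Qed.

Lemma polyfun_le k k' g : (k <= k')%N -> polyfun k g -> polyfun k' g.
Proof.
move=> kk [s s1 s2]; exists s => //; apply: sub_all s1 => m /forallP h.
by apply/forallP => i; apply: leq_trans kk.
Qed.

Lemma polyfun_const k (c : F) : polyfun k (fun=> c).
Proof.
exists [:: (c, [ffun=> 0%N])].
  by rewrite /= andbT; apply/forallP => i; rewrite ffunE.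
by move=> z; rewrite big_seq1 /= big1 ?mulr1 // => i _; rewrite ffunE.
Qed.

Lemma polyfun_var k i : (0 < k)%N -> polyfun k (fun z => z i).
Proof.
move=> k0; exists [:: (1, [ffun j => (i == j : nat)])].
  by rewrite /= andbT; apply/forallP => j; rewrite ffunE; case: (_ == _).
move=> z; rewrite big_seq1 /= mul1r (bigD1 i) //= ffunE eqxx big1 ?mulr1 //.
by move=> j ji; rewrite ffunE eq_sym (negbTE ji).
Qed.

Lemma polyfunD k g h : polyfun k g -> polyfun k h -> polyfun k (fun z => g z + h z).
Proof.
move=> [s s1 s2] [t t1 t2]; exists (s ++ t); first by rewrite all_cat s1 t1.
by move=> z; rewrite big_cat s2 t2.
Qed.

Lemma polyfunM k k' g h :
  polyfun k g -> polyfun k' h -> polyfun (k + k') (fun z => g z * h z).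
Proof.
move=> [s s1 s2] [t t1 t2].
exists [seq (m.1 * m'.1, [ffun i => (m.2 i + m'.2 i)%N]) | m : F * {ffun Z -> nat} <- s, m' : F * {ffun Z -> nat} <- t].
  apply/allP => _ /allpairsP[[m m'] /= [ms mt ->]] /=; apply/forallP => i.
  rewrite ffunE leq_add //.
    by move/allP/(_ _ ms)/forallP: s1; apply.
  by move/allP/(_ _ mt)/forallP: t1; apply.
move=> z; rewrite s2 t2 big_allpairs_dep big_distrlr /=.
apply: eq_bigr => m _; apply: eq_bigr => m' _.
rewrite mulrACA -big_split /=; congr (_ * _); apply: eq_bigr => i _.
by rewrite ffunE exprD.
Qed.

Lemma polyfunN k g : polyfun k g -> polyfun k (fun z => - g z).
Proof.
move=> gP; apply: polyfun_ext (polyfunM (polyfun_const 0 (-1)) gP) => z.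
by rewrite mulN1r.
Qed.

Lemma polyfun_sum (I : Type) (r : seq I) (P : pred I) k (f : I -> (Z -> F) -> F) :
  (forall i, P i -> polyfun k (f i)) -> polyfun k (fun z => \sum_(i <- r | P i) f i z).
Proof.
move=> fP; elim: r => [|i r IH].
  by apply: polyfun_ext (polyfun_const k 0) => z; rewrite big_nil.
case: (boolP (P i)) => Pi; last first.
  by apply: polyfun_ext IH => z; rewrite big_cons (negbTE Pi).
by apply: polyfun_ext (polyfunD (fP i Pi) IH) => z; rewrite big_cons Pi.
Qed.

Lemma polyfun_prod (I : finType) k (f : I -> (Z -> F) -> F) :
  (forall i, polyfun k (f i)) -> polyfun (#|I| * k) (fun z => \prod_i f i z).
Proof.
move=> fP; apply: (@polyfun_ext _ (fun z => \prod_(i <- enum I) f i z)).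
  by move=> z; rewrite big_enum.
rewrite cardE; elim: (enum I) => [|i r IH].
  by apply: polyfun_ext (polyfun_const _ 1) => z; rewrite big_nil.
by apply: polyfun_ext (polyfunM (fP i) IH) => z; rewrite big_cons.
Qed.

Lemma polyfunX k n g : polyfun k g -> polyfun (n * k) (fun z => g z ^+ n).
Proof.
move=> gP; elim: n => [|n IH]; first exact: polyfun_const.
by apply: polyfun_ext (polyfunM gP IH) => z; rewrite exprS.
Qed.

Lemma polyfun_det n k (A : (Z -> F) -> 'M[F]_n) :
  (forall i j, polyfun k (fun z => A z i j)) -> polyfun (n * k) (fun z => \det (A z)).
Proof.
move=> AP; apply: polyfun_sum => s _.
rewrite -[(n * k)%N]add0n; apply: polyfunM; first exact: polyfun_const.
by rewrite -{1}[n]card_ord; apply: polyfun_prod => i; apply: AP.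
Qed.

(** A normal form with [k.+1 ^ #|Z|] coefficients, which makes dimension counts possible. *)
Lemma polyfun_coef k g : polyfun k g ->
  exists a : {ffun Z -> 'I_k.+1} -> F,
    forall z, g z = \sum_e a e * \prod_i z i ^+ e i.
Proof.
move=> [s s1 s2].
pose d (m : F * {ffun Z -> nat}) : {ffun Z -> 'I_k.+1} := [ffun i => inord (m.2 i)].
exists (fun e => \sum_(m <- s | d m == e) m.1) => z.
under eq_bigr do rewrite big_distrl /=.
rewrite (exchange_big_dep xpredT) //= s2 big_seq [RHS]big_seq; apply: eq_bigr => m ms.
rewrite [RHS](big_pred1 (d m)) => [|e]; last by rewrite /= eq_sym.
congr (_ * _); apply: eq_bigr => i _; rewrite ffunE inordK //.
by rewrite ltnS; move/allP/(_ _ ms)/forallP: s1; apply.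
Qed.

End PolyFun.

(** * Linear dependence of polynomial functions and vanishing on grids *)

Section Kernel.
Local Open Scope ring_scope.
Variable F : fieldType.

(** A homogeneous linear system with an unknown for each element of [X] and an equation for each [t]
    and each exponent vector; one solution serves all [t]. *)
Lemma polyfun_kernel (I X : finType) (Z : I -> finType) (g : forall t, X -> (Z t -> F) -> F) d M :
  (forall t x, polyfun M (g t x)) -> (forall t, (#|Z t| <= d)%N) ->
  (#|I| * M.+1 ^ d < #|X|)%N ->
  exists2 c : X -> F, (exists x, c x != 0) &
    forall t z, \sum_x c x * g t x z = 0.
Proof.
move=> gP Zd big.
have /fin_all_exists[a aP] : forall t, exists a : X -> {ffun Z t -> 'I_M.+1} -> F,
    forall x z, g t x z = \sum_e a x e * \prod_i z i ^+ e i.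
  move=> t; have /fin_all_exists[a aP] := fun x => polyfun_coef (gP t x).
  by exists a.
pose S : finType := {t : I & {ffun Z t -> 'I_M.+1}}.
have cS : (#|S| < #|X|)%N.
  apply: leq_ltn_trans big; rewrite card_tagged sumnE big_map big_enum /= -sum_nat_const.
  apply: leq_sum => t _; rewrite card_ffun card_ord.
  by rewrite leq_pexp2l.
pose A := \matrix_(i < #|X|, j < #|S|)
  a (tag (enum_val j)) (enum_val i) (tagged (enum_val j)).
have kA : kermx A != 0.
  rewrite kermx_eq0 -row_leq_rank -ltnNge.
  by apply: leq_ltn_trans cS; apply: rank_leq_col.
pose v := nz_row (kermx A).
have v0 : v != 0 by rewrite nz_row_eq0.
have vA : v *m A = 0 by apply/sub_kermxP; apply: nz_row_sub.
exists (fun x => v 0 (enum_rank x)).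
  have /rV0Pn[i vi] := v0; exists (enum_val i); by rewrite enum_valK.
move=> t z; under eq_bigr do rewrite aP big_distrr /=.
rewrite exchange_big big1 //= => e _.
under eq_bigr do rewrite mulrA; rewrite -big_distrl /=.
suff -> : \sum_x v 0 (enum_rank x) * a t x e = 0 by rewrite mul0r.
have := congr1 (fun B : 'rV_#|S| => B 0 (enum_rank (Tagged (fun t => {ffun Z t -> 'I_M.+1}) e : S))) vA.
rewrite !mxE => vAe; rewrite -[RHS]vAe [RHS](reindex_onto (@enum_rank X) enum_val) /=; last first.
  by move=> i _; rewrite enum_valK.
rewrite [RHS](eq_bigl xpredT) => [|x]; last by rewrite enum_rankK eqxx.
by apply: eq_bigr => x _; rewrite mxE !enum_rankK.
Qed.

(** Evaluation on the grid is a tensor product of Vandermonde matrices with distinct nodes, hence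
    invertible. *)
Lemma grid_nonzero (I : finType) D (c : {ffun I -> 'I_D.+1} -> F) (s : I -> 'I_D.+1 -> F) :
  (forall i, injective (s i)) ->
  (forall m : {ffun I -> 'I_D.+1}, \sum_e c e * \prod_i s i (m i) ^+ e i = 0) ->
  forall e, c e = 0.
Proof.
move=> sI s0 e.
pose V i : 'M[F]_D.+1 := Vandermonde D.+1 (\row_j s i j).
have Vu i : V i \in unitmx.
  rewrite unitmxE det_Vandermonde unitfE; apply/prodf_neq0 => j _; apply/prodf_neq0 => k jk.
  by rewrite !mxE subr_eq0 (inj_eq (sI i)) neq_ltn jk orbT.
(* The product is the Kronecker delta of [e'] and [e]. Once it is expanded, the sum over [e'] is the
   value at a grid point [m]. *)
have -> : c e = \sum_e' c e' * \prod_i (V i *m invmx (V i)) (e' i) (e i).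
  rewrite (bigD1 e) //= big1 ?mulr1 ?big1 ?addr0 ?mulr1 //.
  - by move=> e' ne; have [i ni] : exists i, e' i != e i;
      [apply/existsP; rewrite -negb_forall; apply: contra ne => /forallP h; apply/eqP/ffunP => i; apply/eqP
      |rewrite (bigD1 i) //= mulmxV // mxE (negbTE ni) mul0r mulr0].
  - by move=> i _; rewrite mulmxV // mxE eqxx.
under eq_bigr => e' _ do (under eq_bigr do rewrite mxE; rewrite bigA_distr_bigA big_distrr /=).
rewrite exchange_big big1 //= => m _.
under eq_bigr => e' _ do rewrite big_split mulrA /=.
rewrite -big_distrl /= (_ : \sum_e' _ = 0) ?mul0r // -[RHS](s0 m).
by apply: eq_bigr => e' _; congr (_ * _); apply: eq_bigr => i _; rewrite !mxE.
Qed.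

End Kernel.

(** * An algebraic host graph *)

Section Host.
Local Open Scope ring_scope.
Variables (F : fieldType) (a c ell N : nat) (lam : 'I_ell.+1 -> F).
Let C : finType := ('I_a + 'I_c)%type.

Definition sep (x y : C -> F) (k : C + 'I_c) : F :=
  match k with inl i => x i | inr j => y (inr j) end.

(** The value at [lam l] of the polynomial whose coefficients are the entries of [sep x y]; distinct
    vectors have distinct slopes for all but few [l]. *)
Definition slope l (x y : C -> F) : F :=
  \sum_(k : C + 'I_c) lam l ^+ enum_rank k * sep x y k.

(** A polynomial in each slope: whichever [l] separates given edges, their equations form a
    Vandermonde system in the [t (j, l, k)]. *)
Definition hostpoly (t : 'I_a * 'I_ell.+1 * 'I_N -> F) j (x y : C -> F) : F :=
  \sum_l \sum_k t (j, l, k) * slope l x y ^+ k.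

(* The [inl] coordinates of [y] are determined by [sep x y]: the number of edges
   does not depend on [t], and distinct edges have distinct [sep x y]. *)
Definition hostadj t (x y : C -> F) : bool :=
  [forall j, y (inl j) == hostpoly t j x y].

Lemma slope_ext l x y x' y' : sep x y =1 sep x' y' -> slope l x y = slope l x' y'.
Proof. by move=> E; apply: eq_bigr => k _; rewrite E. Qed.

Lemma hostpoly_ext t j x y x' y' : sep x y =1 sep x' y' -> hostpoly t j x y = hostpoly t j x' y'.
Proof.
by move=> E; apply: eq_bigr => l _; apply: eq_bigr => k _; rewrite (slope_ext l E).
Qed.

Lemma hostadj_inj t x y x' y' : hostadj t x y -> hostadj t x' y' ->
  sep x y =1 sep x' y' -> x =1 x' /\ y =1 y'.
Proof.
move=> /forallP h /forallP h' E; split=> [i|[j|j]]; first exact: (E (inl i)).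
  by rewrite (eqP (h j)) (eqP (h' j)); apply: hostpoly_ext.
exact: (E (inr j)).
Qed.

(** For distinct [i] and [i'], the difference of slopes is a nonzero polynomial in [lam l] of
    bounded degree. Each pair thus excludes few [l], and [ell.+1] exceeds the total excluded. *)
Lemma slope_separates (I : finType) (x y : I -> C -> F) :
  injective lam ->
  (forall i i', sep (x i) (y i) =1 sep (x i') (y i') -> i = i') ->
  (#|I| * #|I| * #|{: C + 'I_c}| <= ell)%N ->
  exists l, injective (fun i => slope l (x i) (y i)).
Proof.
move=> lamI sepI big.
pose bad l (q : I * I) := (q.1 != q.2) && (slope l (x q.1) (y q.1) == slope l (x q.2) (y q.2)).
have few q : (#|[set l | bad l q]| <= #|{: C + 'I_c}|)%N.
  case: (eqVneq q.1 q.2) => [E|ne].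
    by rewrite (_ : [set l | _] = set0) ?cards0 //; apply/setP => l; rewrite !inE /bad E eqxx.
  pose d k := sep (x q.1) (y q.1) k - sep (x q.2) (y q.2) k.
  pose P := \poly_(i < #|{: C + 'I_c}|)
    (if insub i is Some i' then d (enum_val (i' : 'I_#|{: C + 'I_c}|)) else 0).
  have PE l : P.[lam l] = slope l (x q.1) (y q.1) - slope l (x q.2) (y q.2).
    rewrite horner_poly /slope -sumrB (reindex_onto enum_rank enum_val) /=; last first.
      by move=> i _; rewrite enum_valK.
    rewrite (eq_bigl xpredT) => [|k]; last by rewrite enum_rankK eqxx.
    by apply: eq_bigr => k _; rewrite valK enum_rankK mulrC /d mulrBr.
  have P0 : P != 0.
    apply: contraNneq ne => P0; apply/eqP; apply: sepI => k; apply/eqP; rewrite -subr_eq0.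
    have : P`_(enum_rank k) = 0 by rewrite P0 coef0.
    by rewrite coef_poly ltn_ord valK enum_rankK => /eqP.
  rewrite cardE -(size_map lam); apply: leq_trans (size_poly _ _).
  apply/ltnW/(max_poly_roots P0); last by rewrite map_inj_uniq // enum_uniq.
  apply/allP => u /mapP[l]; rewrite mem_enum inE => /andP[_ /eqP E] ->.
  by rewrite /root PE E subrr.
case: (boolP [exists l, [forall q, ~~ bad l q]]) => [/existsP[l /forallP h]|].
  exists l => i i' E; apply/eqP; move: (h (i, i')).
  by rewrite /bad /= E eqxx andbT negbK.
rewrite negb_exists => /forallP h; exfalso.
have : (\sum_(l < ell.+1) 1 <= \sum_(l < ell.+1) \sum_q bad l q)%N.
  apply: leq_sum => l _; move: (h l); rewrite negb_forall => /existsP[q]; rewrite negbK => bq.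
  by rewrite (bigD1 q) //= bq.
rewrite exchange_big sum1_card card_ord /= leqNgt => /negP; apply.
rewrite ltnS; apply: leq_trans big; rewrite -card_prod -sum_nat_const; apply: leq_sum => q _.
apply: leq_trans (few q); rewrite -sum1_card [leqRHS]big_mkcond; apply: leq_sum => l _.
by rewrite inE; case: (bad l q).
Qed.

End Host.

(** * Solving for the coefficients of the host *)

Section Config.
Local Open Scope ring_scope.
Variables (F : fieldType) (T : rooted_graph) (a c ell K : nat) (lam : 'I_ell.+1 -> F).
Let C : finType := ('I_a + 'I_c)%type.
Let row : finType := ('I_K * edge T)%type.
Let N := #|{: row}|.
Let coef : finType := ('I_a * 'I_ell.+1 * 'I_N)%type.

(** [aend] and [bend] are the ends of an edge on the [false] and on the [true] side of the host;
    [beta] tells whether the colouring is flipped there. *)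
Definition aend (beta : bool) (r : row) : pow_vertex T K :=
  if beta (+) cinner (val r.2).1 then far_end r.2 r.1 else near_end r.2 r.1.
Definition bend (beta : bool) (r : row) : pow_vertex T K :=
  if beta (+) cinner (val r.2).1 then near_end r.2 r.1 else far_end r.2 r.1.

Lemma abend_inj beta r r' : aend beta r = aend beta r' -> bend beta r = bend beta r' -> r = r'.
Proof.
move=> Ea Eb; case: r r' Ea Eb => [i q] [i' q'] Ea Eb.
suff /ends_inj[-> ->] : [set near_end q i; far_end q i] = [set near_end q' i'; far_end q' i'] by [].
have E k q0 : [set near_end q0 k; far_end q0 k] = [set aend beta (k, q0); bend beta (k, q0)].
  by rewrite /aend /bend /=; case: (_ (+) _) => //; rewrite setUC.
by rewrite !E Ea Eb.
Qed.

(* The free parameters once the coefficients of index [l] are eliminated: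
   coordinates of the vertices, and coefficients of index [lift l _]. *)
Definition param : finType := (pow_vertex T K * C + 'I_a * 'I_ell * 'I_N)%type.

Section Eliminate.
Variables (beta : bool) (l : 'I_ell.+1).
Implicit Type z : param -> F.

Definition vcoord z (v : pow_vertex T K) : C -> F := fun k => z (inl (v, k)).
Definition rslope z l' (r : 'I_N) : F :=
  slope lam l' (vcoord z (aend beta (enum_val r))) (vcoord z (bend beta (enum_val r))).
Definition elimV z : 'M[F]_N := \matrix_(r, k) rslope z l r ^+ k.
Definition elimdet z : F := \det (elimV z).
Definition elimrhs z j r : F :=
  vcoord z (bend beta (enum_val r)) (inl j) -
  \sum_m \sum_k z (inr (j, m, k)) * rslope z (lift l m) r ^+ k.
(** Cramer's rule with common denominator [elimdet]: coefficients of index [l] come from the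
    adjugate, the others are parameters. *)
Definition elimnum (i : coef) z : F :=
  match unlift l i.1.2 with
  | Some m => z (inr (i.1.1, m, i.2)) * elimdet z
  | None => \sum_r (\adj (elimV z)) i.2 r * elimrhs z i.1.1 r
  end.

(** Cofactors have degree at most [N.-1 * N] and [elimrhs] at most [N + 1]; a parameter times
    [elimdet] has degree at most [1 + N * N]. *)
Definition elimdeg := (N * N + N + 1)%N.

Lemma polyfun_rslope l' r : polyfun 1 (fun z => rslope z l' r).
Proof.
apply: polyfun_sum => k _; rewrite -[1%N]add0n; apply: polyfunM; first exact: polyfun_const.
by case: k => [k|k]; apply: polyfun_var.
Qed.

Lemma polyfun_rslopeX l' r (k : 'I_N) : polyfun N (fun z => rslope z l' r ^+ k).
Proof.
apply: (@polyfun_le _ _ (k * 1)); first by rewrite muln1 ltnW.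
exact/polyfunX/polyfun_rslope.
Qed.

Lemma polyfun_elimdet : polyfun (N * N) elimdet.
Proof.
apply: polyfun_det => r k.
by apply: polyfun_ext (polyfun_rslopeX l r k) => z; rewrite mxE.
Qed.

Lemma polyfun_elimnum i : polyfun elimdeg (elimnum i).
Proof.
rewrite /elimnum /elimdeg; case: (unlift _ _) => [m|].
  apply: (@polyfun_le _ _ (1 + N * N)); first lia.
  apply: polyfunM; [exact: polyfun_var|exact: polyfun_elimdet].
apply: polyfun_sum => r _.
apply: (@polyfun_le _ _ (N.-1 * N + (N + 1))); first by rewrite addnA !leq_add2r leq_mul2r leq_pred orbT.
apply: polyfunM.
  apply: (@polyfun_ext _ _ _ (fun z => cofactor (elimV z) r i.2)) => [z|]; first by rewrite !mxE.
  rewrite /cofactor -[(N.-1 * N)%N]add0n; apply: polyfunM; first exact: polyfun_const.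
  apply: polyfun_det => r' k.
  by apply: polyfun_ext (polyfun_rslopeX l _ _) => z; rewrite !mxE.
apply: polyfunD; first by apply: polyfun_var; rewrite addn1.
apply: polyfunN; apply: polyfun_sum => m _; apply: polyfun_sum => k _.
by rewrite addnC; apply: polyfunM; [exact: polyfun_var|exact: polyfun_rslopeX].
Qed.

Lemma elimdet_neq0 z : injective (rslope z l) -> elimdet z != 0.
Proof.
move=> rI; rewrite /elimdet (_ : elimV z = (Vandermonde N (\row_r rslope z l r))^T).
  rewrite det_tr det_Vandermonde; apply/prodf_neq0 => j _; apply/prodf_neq0 => k jk.
  by rewrite !mxE subr_eq0 (inj_eq rI) neq_ltn jk orbT.
by apply/matrixP => r k; rewrite !mxE.
Qed.

(** The adjacencies say that [elimV z] maps the coefficients of index [l] to [elimrhs]; multiply by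
    the adjugate. *)
Lemma elimP (t : coef -> F) (x : pow_vertex T K -> C -> F) z :
  z =1 (fun i => match i with inl (v, k) => x v k | inr (j, m, k) => t (j, lift l m, k) end) ->
  (forall r, hostadj lam t (x (aend beta r)) (x (bend beta r))) ->
  forall i, t i * elimdet z = elimnum i z.
Proof.
move=> zE tP [[j l'] k]; rewrite /elimnum /=.
case: unliftP => [m ->|->]; first by rewrite zE.
pose tv := \col_k t (j, l, k).
have -> : t (j, l, k) * elimdet z = (elimdet z *: tv) k 0 by rewrite !mxE mulrC.
rewrite -mul_scalar_mx /elimdet -mul_adj_mx -mulmxA mxE; apply: eq_bigr => r _; congr (_ * _).
have rE l0 : rslope z l0 r = slope lam l0 (x (aend beta (enum_val r))) (x (bend beta (enum_val r))).
  by apply: slope_ext => -[i|i] /=; rewrite /vcoord zE.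
rewrite mxE /elimrhs /vcoord zE (eqP (forallP (tP (enum_val r)) j)) /hostpoly.
under [X in _ = _ - X]eq_bigr => m _ do under eq_bigr => k' _ do rewrite zE rE.
rewrite (bigD1_ord l) //= addrK.
by apply: eq_bigr => k' _; rewrite !mxE rE mulrC.
Qed.

End Eliminate.

End Config.

(** * A host without large powers of [T] *)

Definition hostrel (F : fieldType) a c ell N (lam : 'I_ell.+1 -> F)
    (t : 'I_a * 'I_ell.+1 * 'I_N -> F) : rel (bool * {ffun 'I_a + 'I_c -> F}) :=
  fun x y => (~~ x.1 && y.1 && hostadj lam t x.2 y.2) || (x.1 && ~~ y.1 && hostadj lam t y.2 x.2).

Lemma inj_of_card (W : finType) n : n <= #|W| -> exists s : 'I_n -> W, injective s.
Proof.
move=> nW; exists (fun i => enum_val (widen_ord nW i)) => i j /enum_val_inj/(congr1 val) E.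
exact: val_inj.
Qed.

(** Otherwise ranking the values in each coordinate would inject [V] into the functions from [C] to
    ['I_m.+1]. *)
Lemma many_values (V C W : finType) (f : V -> C -> W) m :
  (forall v v', f v =1 f v' -> v = v') -> m.+1 ^ #|C| < #|V| ->
  exists k, m.+1 < #|[set f v k | v : V]|.
Proof.
move=> fI big; case: (boolP [exists k, m.+1 < #|[set f v k | v : V]|]) => [/existsP//|].
rewrite negb_exists => /forallP h; exfalso; move: big; rewrite ltnNge => /negP; apply.
rewrite -[m.+1]card_ord -card_ffun.
pose Y k := enum [set f v k | v : V].
have inY v k : f v k \in Y k by rewrite mem_enum; apply: imset_f.
apply: (@leq_card _ _ (fun v => [ffun k => inord (index (f v k) (Y k))] : {ffun C -> 'I_m.+1})).
move=> v v' /ffunP E; apply: fI => k; move: (E k); rewrite !ffunE => /(congr1 val) /=.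
have lt u : index (f u k) (Y k) < m.+1.
  by apply: leq_trans (_ : size (Y k) <= _); rewrite ?index_mem // -cardE leqNgt.
rewrite !inordK // => E'.
by rewrite -[LHS](nth_index (f v k) (inY v k)) E' nth_index.
Qed.

Section HostFree.
Local Open Scope ring_scope.
Variables (T : rooted_graph) (a c : nat) (u0 : inner T).
Hypothesis dens : ((a + c) * #|inner T| <= a * #|edge T|)%N.
Let C : finType := ('I_a + 'I_c)%type.
(** One copy more than the roots have coordinates, so that [#|coef| + K = d.+1]. *)
Let K := ((a + c) * #|outer T|).+1.
Let N := #|{: 'I_K * edge T}|.
Let ell := (N * N * #|{: C + 'I_c}|)%N.
Let coef : finType := ('I_a * 'I_ell.+1 * 'I_N)%type.
Let I : finType := (bool * 'I_ell.+1 * C)%type.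
Let d := (#|coef| + (a + c) * #|outer T|)%N.
Let D1 := elimdeg T K.
Let B := (#|coef| * D1 + K).+1.
(** Makes the number of equations in [dependence] at most [D * D.+1 ^ d], below the number
    [D.+1 ^ d.+1] of monomials. *)
Let D := (#|I| * B ^ d)%N.
Let X : finType := ({ffun coef -> 'I_D.+1} * {ffun 'I_K -> 'I_D.+1})%type.

(** Elimination saves [a] coefficients for each edge of [T^K]. By [dens] this pays for the
    coordinates of all inner vertices, and only those of the roots remain. *)
Lemma card_param_le : (#|param T a c ell K| <= d)%N.
Proof.
rewrite /d /param /coef !(card_sum, card_prod, card_ord) -/N.
have NE : N = (K * #|edge T|)%N by rewrite /N card_prod card_ord.
move: (leq_mul dens (leqnn K)); rewrite -[(a * #|edge T| * K)%N]mulnA [(#|edge T| * K)%N]mulnC -NE.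
move: K #|edge T| N ell #|inner T| #|outer T| => k e n l i o; nia.
Qed.

Variable F : finFieldType.

Definition depeval (cf : X -> F) (t : coef -> F) (y : 'I_K -> F) : F :=
  \sum_(e : X) cf e * ((\prod_i t i ^+ e.1 i) * \prod_k y k ^+ e.2 k).

(* More functions than parameters: the coefficients of the host and one
   coordinate in each of the [K] copies are algebraically dependent. *)
Lemma dependence (lam : 'I_ell.+1 -> F) :
  exists2 cf : X -> F, (exists e, cf e != 0) &
  forall beta l cc (t : coef -> F) (x : pow_vertex T K -> C -> F),
    (forall r, hostadj lam t (x (aend beta r)) (x (bend beta r))) ->
    injective (fun r => slope lam l (x (aend beta r)) (x (bend beta r))) ->
    depeval cf t (fun k => x (inr (u0, k)) cc) = 0.
Proof.
(* The monomial [e] with [elimnum / elimdet] put for each coefficient, times [elimdet ^+ D] per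
   coefficient to clear denominators. The index [s] makes one relation serve every orientation,
   slope and coordinate. *)
pose g (s : I) (e : X) (z : param T a c ell K -> F) :=
  (\prod_i (elimnum lam s.1.1 s.1.2 i z ^+ e.1 i * elimdet lam s.1.1 s.1.2 z ^+ (D - e.1 i))) *
  \prod_k z (inl (inr (u0, k), s.2)) ^+ e.2 k.
have gP s e : polyfun (#|coef| * (D * D1) + K * D) (g s e).
  apply: polyfunM.
    apply: polyfun_prod => i.
    have eD : (e.1 i <= D)%N by rewrite -ltnS.
    have -> : (D * D1 = e.1 i * D1 + (D - e.1 i) * D1)%N by rewrite -mulnDl subnKC.
    apply: polyfunM; first exact/polyfunX/polyfun_elimnum.
    apply/polyfunX/polyfun_le/polyfun_elimdet.
    by rewrite /D1 /elimdeg -addnA leq_addr.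
  have -> : (K * D = #|'I_K| * D)%N by rewrite card_ord.
  apply: polyfun_prod => k.
  apply: (@polyfun_le _ _ (e.2 k * 1)); first by rewrite muln1 -ltnS.
  exact/polyfunX/polyfun_var.
have big : (#|I| * (#|coef| * (D * D1) + K * D).+1 ^ d < #|X|)%N.
  have -> : #|X| = (D.+1 ^ (#|coef| + K))%N by rewrite card_prod !card_ffun !card_ord expnD.
  have -> : (#|coef| + K)%N = d.+1 by rewrite /K /d addnS.
  have le : ((#|coef| * (D * D1) + K * D).+1 <= B * D.+1)%N by rewrite /B; nia.
  apply: (@leq_ltn_trans (D * D.+1 ^ d)); last by rewrite expnS ltn_pmul2r ?expn_gt0.
  apply: (@leq_trans (#|I| * (B * D.+1) ^ d)); last by rewrite expnMn mulnA.
  by rewrite leq_mul2l; apply/orP; right; case: (posnP d) => [->//|d0]; rewrite leq_exp2r.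
have [cf cf0 cfP] := polyfun_kernel gP (fun=> card_param_le) big.
exists cf => // beta l cc t x tP inj.
pose z (i : param T a c ell K) : F :=
  match i with inl (v, k) => x v k | inr (j, m, k) => t (j, lift l m, k) end.
have zP := elimP (l := l) (frefl z) tP.
have d0 : elimdet lam beta l z != 0.
  by apply: elimdet_neq0 => r r' /inj; apply: enum_val_inj.
apply: (mulIf (expf_neq0 (D * #|coef|)%N d0)); rewrite mul0r -[RHS](cfP (beta, l, cc) z).
rewrite /depeval big_distrl; apply: eq_bigr => e _ /=; rewrite -mulrA; congr (_ * _).
rewrite mulrAC /g /=; congr (_ * _).
rewrite exprM -prodr_const -big_split; apply: eq_bigr => i _ /=.
by rewrite -zP exprMn -mulrA -exprD subnKC // -ltnS.
Qed.

(** View the relation as a polynomial in [y] whose coefficients [h t e'] depend on [t]. One of them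
    is nonzero at a suitable [t], and then the relation cannot vanish on any grid of side [D.+1]. *)
Lemma good_coef (cf : X -> F) : (D < #|F|)%N -> (exists e, cf e != 0) ->
  exists t, forall Y : 'I_K -> 'I_D.+1 -> F, (forall k, injective (Y k)) ->
  exists m : {ffun 'I_K -> 'I_D.+1}, depeval cf t (fun k => Y k (m k)) != 0.
Proof.
move=> DF [[e0 e1] cf0]; have [s sI] := inj_of_card DF.
pose h (t : coef -> F) e' := \sum_e cf (e, e') * \prod_i t i ^+ e i.
have [m hm] : exists m : {ffun coef -> 'I_D.+1}, h (s \o m) e1 != 0.
  apply/existsP; apply: contraNT cf0; rewrite negb_exists => /forallP h0; apply/eqP.
  apply: (grid_nonzero (c := fun e => cf (e, e1)) (s := fun=> s)) => // m.
  by move: (h0 m); rewrite negbK => /eqP.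
exists (s \o m) => Y YI; apply/existsP; apply: contraNT hm.
rewrite negb_exists => /forallP h0; apply/eqP.
apply: (grid_nonzero (c := h (s \o m)) YI) => m'.
move: (h0 m'); rewrite negbK => /eqP E0; rewrite -[RHS]E0 /depeval.
transitivity (\sum_e \sum_e' cf (e, e') *
    ((\prod_i (s \o m) i ^+ e i) * \prod_k Y k (m' k) ^+ e' k)).
  rewrite [RHS]exchange_big; apply: eq_bigr => e' _; rewrite /h big_distrl; apply: eq_bigr => e _ /=.
  by rewrite mulrA.
by rewrite pair_bigA; apply: eq_bigr => -[e e'] _.
Qed.

(** Many copies over the same roots give many values of some coordinate at [u0]. In [K] groups of
    [D.+1] copies, [good_coef] picks one copy per group where the relation does not vanish; but
    these copies form [T^K], where it does. *)
Lemma hostrel_free : (D < #|F|)%N -> (ell < #|F|)%N ->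
  exists lam (t : coef -> F),
    ~ embeds (pow_rel T ((K * D.+1) ^ (a + c)).+1) (hostrel (c := c) lam t).
Proof.
move=> DF lF; have [lam lamI] := inj_of_card lF.
(* The relation depends on [lam] only, so [t] can be chosen after it. *)
have [cf cf0 cfP] := dependence lam; have [t tP] := good_coef DF cf0.
exists lam, t => -[f [fI fe]]; set p := (_ ^ _).+1 in f fI fe.
have [beta fb] : exists be, forall u i, (f (inr (u, i))).1 = be (+) cinner u.
  apply: (@pow_col_rigid T p (fun x => (f x).1)) => x y /fe.
  by rewrite /hostrel; case: (f x).1; case: (f y).1.
have [k0 big] : exists k : C, (K * D.+1 < #|[set (f (inr (u0, i))).2 k | i : 'I_p]|)%N.
  have [||k] := @many_values 'I_p C F (fun i => (f (inr (u0, i))).2) (K * D.+1).-1.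
  - move=> i i' /ffunP E; suff /fI[] : f (inr (u0, i)) = f (inr (u0, i')) by [].
    by apply/eqP; rewrite -pair_eqE /pair_eq !fb E !eqxx.
  - by rewrite prednK ?muln_gt0 // card_sum !card_ord.
  - by rewrite prednK ?muln_gt0 // => h; exists k.
have [s sI] : exists s : 'I_K * 'I_D.+1 -> 'I_p, injective (fun q => (f (inr (u0, s q))).2 k0).
  set S := [set _ | i : 'I_p] in big.
  have qS (q : 'I_K * 'I_D.+1) : (enum_rank q < #|S|)%N.
    by apply: leq_trans (ltn_ord _) _; rewrite card_prod !card_ord ltnW.
  have /fin_all_exists[s sP] (q : 'I_K * 'I_D.+1) :
      exists i, enum_val (Ordinal (qS q)) = (f (inr (u0, i))).2 k0.
    by have /imsetP[i _ ->] := enum_valP (Ordinal (qS q)); exists i.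
  exists s => q q'; rewrite -!sP => /enum_val_inj/(congr1 val) /= E.
  exact/enum_rank_inj/val_inj.
have [k q q' E|m] := tP (fun k m => (f (inr (u0, s (k, m)))).2 k0).
  by case: (sI _ _ E).
case/eqP; pose sk k := s (k, m k).
have skI : injective sk by move=> k k' E; case: (sI (k, m k) (k', m k') (congr1 (fun i => (f (inr (u0, i))).2 k0) E)).
pose g (v : pow_vertex T K) := f (match v with inl r => inl r | inr (u, k) => inr (u, sk k) end).
have gI : injective g.
  by move=> [r|[u k]] [r'|[u' k']] /fI // [] => [->|-> /skI ->].
have ge x y : pow_rel T K x y -> hostrel lam t (g x) (g y).
  move=> xy; apply: fe; case: x y xy => [r|[u k]] [r'|[u' k']] //=.
  by case/andP=> /eqP-> ->; rewrite eqxx.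
have abP (r : 'I_K * edge T) : [/\ ~~ (g (aend beta r)).1, (g (bend beta r)).1 &
    hostadj lam t (g (aend beta r)).2 (g (bend beta r)).2].
  have := ge _ _ (pow_rel_ends r.2 r.1); rewrite /aend /bend.
  have := fb (val r.2).1 (sk r.1); rewrite -/(g (near_end r.2 r.1)) /hostrel => <-.
  case E: (g (near_end _ _)).1 => /=; rewrite ?orbF => /andP[h1 h2]; split=> //.
  exact: negbT E.
pose x v : C -> F := (g v).2.
have xP r : hostadj lam t (x (aend beta r)) (x (bend beta r)) by case: (abP r).
have [l lI] : exists l, injective (fun r => slope lam l (x (aend beta r)) (x (bend beta r))).
  apply: slope_separates => // r r' E.
  have [/ffunP Ea /ffunP Eb] := hostadj_inj (xP r) (xP r') E.
  apply: (@abend_inj _ _ beta); apply: gI; apply/eqP; rewrite -pair_eqE /pair_eq ?Ea ?Eb eqxx andbT.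
    by have [/negbTE-> _ _] := abP r; have [/negbTE-> _ _] := abP r'.
  by have [_ -> _] := abP r; have [_ -> _] := abP r'.
exact: cfP k0 t x xP lI.
Qed.

End HostFree.

Lemma card_hostrel (F : finFieldType) a c ell N (lam : 'I_ell.+1 -> F)
    (t : 'I_a * 'I_ell.+1 * 'I_N -> F) :
  #|F| ^ (a + c + c) <= #|[set q | hostrel (c := c) lam t q.1 q.2]|.
Proof.
(* [sep] does not read the first coordinates of [y], so 0 can stand there. *)
pose ext (v : {ffun 'I_c -> F}) : 'I_a + 'I_c -> F := fun k => if k is inr j then v j else 0%R.
pose y (x : {ffun 'I_a + 'I_c -> F}) v : {ffun 'I_a + 'I_c -> F} :=
  [ffun k => match k with inl j => hostpoly lam t j x (ext v) | inr j => v j end].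
pose h (q : {ffun 'I_a + 'I_c -> F} * {ffun 'I_c -> F}) := ((false, q.1), (true, y q.1 q.2)).
have hI : injective h.
  move=> [x v] [x' v'] [-> E]; congr pair; apply/ffunP => j.
  by move/ffunP/(_ (inr j)): E; rewrite !ffunE.
have -> : #|F| ^ (a + c + c) = #|[set h q | q : {ffun 'I_a + 'I_c -> F} * {ffun 'I_c -> F}]|.
  by rewrite card_imset // card_prod !card_ffun card_sum !card_ord expnD.
apply: subset_leq_card; apply/subsetP => _ /imsetP[[x v] _ ->]; rewrite inE /hostrel /=.
rewrite orbF; apply/forallP => j; rewrite ffunE; apply/eqP.
by apply: hostpoly_ext => -[i|i] //=; rewrite ffunE.
Qed.

(** Over the field with [q = 2 ^ m] elements the host has [2 * q ^ (a + c)] vertices; [p] and [M]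
    are fixed before [m]. *)
Lemma ex_pow_ge (T : rooted_graph) a c : (a + c) * #|inner T| <= a * #|edge T| ->
  exists p M, [/\ 0 < p & forall m n, M <= m -> 2 * (2 ^ m) ^ (a + c) <= n ->
    (2 ^ m) ^ (a + c + c) <= 2 * ex n (pow_rel T p)].
Proof.
move=> dens; have [u0 _] := outer_edge T.
have := hostrel_free u0 dens.
set D := (_ * _ ^ _); set ell := (_ * _ * _); set p := ((_ * D.+1) ^ _).+1 => h.
exists p, (maxn D ell).+1; split=> // m n Mm mn.
have [F _ cF] := pPrimePowerField (isT : prime 2) (leq_ltn_trans (leq0n _) Mm).
have lt : maxn D ell < #|F|.
  by rewrite cF; apply: leq_trans Mm _; apply: ltnW; apply: ltn_expl.
have [lam [t nt]] := h F (leq_ltn_trans (leq_maxl _ _) lt) (leq_ltn_trans (leq_maxr _ _) lt).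
rewrite -cF in mn *; apply: leq_trans (card_hostrel c lam t) _.
apply: (card_rel_le_ex (S := setT) _ _ _ _ _ nt) => //.
- by move=> x; apply: pow_noniso.
- by move=> [[] x]; rewrite /hostrel /=.
- by move=> x y; rewrite /hostrel orbC ![_ && ~~ _]andbC.
- by rewrite cardsT card_prod card_bool card_ffun card_sum !card_ord.
Qed.

(** * Asymptotics *)

Local Open Scope R_scope.

Lemma INR_leq m n : (m <= n)%N -> INR m <= INR n.
Proof. by move/leP/le_INR. Qed.

Lemma INR_ltn m n : (m < n)%N -> INR m < INR n.
Proof. by move/ltP/lt_INR. Qed.

Lemma INR_muln m n : INR (m * n)%N = INR m * INR n.
Proof. exact: mult_INR. Qed.

Lemma INR_addn m n : INR (m + n)%N = INR m + INR n.
Proof. exact: plus_INR. Qed.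

Lemma INR_expn m n : INR (m ^ n)%N = INR m ^ n.
Proof. by elim: n => [|n IH] //=; rewrite expnS INR_muln IH. Qed.

Lemma INR_pos n : (0 < n)%N -> 0 < INR n.
Proof. by move/INR_ltn. Qed.

Lemma ex_rstar n p : (ex n (pow_rel rstar p) <= p * n)%N.
Proof.
apply/bigmax_leqP => G /andP[sG nG].
suff : (#|G| <= p * n)%N by rewrite (nedges_double sG); lia.
have [-> _] := card_pairs G.
have -> : (p * n = \sum_(x < n) p)%N by rewrite sum_nat_const card_ord mulnC.
apply: leq_sum => x _; rewrite leqNgt; apply: contra nG => deg; apply/containsP.
pose s (i : 'I_p) := enum_val (widen_ord (ltnW deg) i).
have sG' i : (x, s i) \in G by have := enum_valP (widen_ord (ltnW deg) i); rewrite inE.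
have [/forallP irr /forallP symG] := andP sG.
have sI : injective s by move=> i j /enum_val_inj/(congr1 val) E; apply: val_inj.
have sx i : s i != x by apply: contraTneq (sG' i) => ->; apply: irr.
exists (fun v : pow_vertex rstar p => match v with inl _ => x | inr (_, i) => s i end); split.
  move=> [[]|[[] i]] [[]|[[] j]] //.
  - by move=> E; case/eqP: (sx j).
  - by move=> E; case/eqP: (sx i).
  - by move/sI->.
move=> [[]|[[] i]] [[]|[[] j]] //=; last by rewrite andbF.
by move=> _; move/forallP/(_ (s i))/eqP: (symG x) => <-.
Qed.

Lemma cone_asymptotic T p alpha : (0 < p)%N -> 0 <= alpha < 1 ->
  bigO (fun n => INR (ex n (pow_rel T p))) (fun n => Rpower (INR n) (1 + alpha)) ->
  bigO (fun n => INR (ex n (pow_rel (cone T) p))) (fun n => Rpower (INR n) (1 + / (2 - alpha))).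
Proof.
move=> p0 [al0 al1] [C [N CN]].
pose C0 := Rmax C 1.
have C1 : 1 <= C0 by apply: Rmax_r.
have CC : C <= C0 by apply: Rmax_l.
pose th := / (2 - alpha).
have th0 : 0 < th by apply: Rinv_0_lt_compat; lra.
exists (8 * (INR N + 2) * Rpower (50 * C0) th), 1%N => n /leP n1.
have n1R : 1 <= INR n by apply: (INR_leq n1).
(* If [s > y] then [s^(2 - alpha) > 50 C0 n]; with [ex(2s) <= 4 C0 s^(1 + alpha)] this excludes the
   second alternative of [cone_nedges]. Adding [N] to [s] makes [CN] apply to [2 * s]. *)
pose y := Rpower (50 * C0 * INR n) th.
have base1 : 1 < 50 * C0 * INR n by nra.
have y1 : 1 <= y.
  by rewrite -(Rpower_O (50 * C0 * INR n)); [apply: Rle_Rpower; lra|lra].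
pose s := (Z.to_nat (up y) + N)%N.
have [up1 up2] := archimed y.
have upZ : INR (Z.to_nat (up y)) = IZR (up y).
  by rewrite INR_IZR_INZ Z2Nat.id //; apply: le_IZR; lra.
have N0 := pos_INR N.
have sR : INR s = IZR (up y) + INR N by rewrite INR_addn upZ.
have s_gt : y < INR s by lra.
have s_le : INR s <= (INR N + 2) * y by nra.
have s0 : (0 < s)%N by apply/ltP/INR_lt; rewrite /=; lra.
have yth : Rpower y (2 - alpha) = 50 * C0 * INR n.
  by rewrite /y Rpower_mult /th Rinv_l ?Rpower_1 //; lra.
have nexp : Rpower (INR n) (1 + th) = INR n * Rpower (INR n) th.
  by rewrite Rpower_plus Rpower_1 //; lra.
have yE : y = Rpower (50 * C0) th * Rpower (INR n) th.
  by rewrite /y Rpower_mult_distr //; lra.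
suff key : (ex n (pow_rel (cone T) p) <= 8 * n * s)%N.
  apply: Rle_trans (INR_leq key) _; rewrite !INR_muln nexp.
  have -> : INR 8 = 8 by rewrite /=; lra.
  rewrite yE in s_le; nra.
apply/bigmax_leqP => G /andP[sG nG].
have [//|h] := cone_nedges p0 s0 sG nG; exfalso.
have e2s : INR (ex (2 * s) (pow_rel T p)) <= C0 * (4 * Rpower (INR s) (1 + alpha)).
  have le : (N <= 2 * s)%coq_nat by apply/leP; rewrite /s; lia.
  apply: Rle_trans (CN _ le) _; rewrite INR_muln.
  rewrite -Rpower_mult_distr; try (rewrite /=; lra).
  have r2 : Rpower (INR 2) (1 + alpha) <= 4.
    have -> : 4 = Rpower (INR 2) 2.
      by rewrite -[X in Rpower _ X]/(INR 2) Rpower_pow /=; lra.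
    by apply: Rle_Rpower; rewrite /=; lra.
  have p1 := exp_pos ((1 + alpha) * ln (INR s)).
  have p2 := exp_pos ((1 + alpha) * ln (INR 2)).
  rewrite -/(Rpower (INR s) (1 + alpha)) in p1; rewrite -/(Rpower (INR 2) (1 + alpha)) in p2.
  apply: Rle_trans (Rmult_le_compat_r _ _ _ _ CC) _; first by nra.
  apply: Rmult_le_compat_l; first lra.
  by apply: Rmult_le_compat_r; lra.
have := INR_leq h; rewrite INR_muln INR_expn !INR_muln.
have -> : INR 2 = 2 by rewrite /=; lra.
have -> : INR 25 = 25 by rewrite /=; lra.
have s3 : INR s ^ 3 = Rpower (INR s) (2 - alpha) * Rpower (INR s) (1 + alpha).
  rewrite -Rpower_plus -Rpower_pow; last lra.
  by congr Rpower; rewrite /=; lra.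
have gt : 50 * C0 * INR n < Rpower (INR s) (2 - alpha).
  by rewrite -yth; apply: Rlt_Rpower_l; lra.
have p1 := exp_pos ((1 + alpha) * ln (INR s)).
rewrite -/(Rpower (INR s) (1 + alpha)) in p1.
rewrite s3; move: (Rpower _ _) (Rpower _ _) (INR (ex _ _)) e2s gt p1 => A B e e2s gt p1.
have h1 : 25 * INR n * e <= 25 * INR n * (C0 * (4 * B)) by apply: Rmult_le_compat_l; lra.
have h2 : 50 * C0 * INR n * B < A * B by apply: Rmult_lt_compat_r.
lra.
Qed.

Lemma INR_expn_Rpower m n : (0 < m)%N -> INR (m ^ n)%N = Rpower (INR m) (INR n).
Proof. by move=> m0; rewrite INR_expn Rpower_pow //; apply: INR_pos. Qed.

Lemma dyadic_scale b M n : (0 < b)%N -> (2 * (2 ^ M) ^ b <= n)%N ->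
  exists m, [/\ (M <= m)%N, (2 * (2 ^ m) ^ b <= n)%N & (n < 2 * (2 ^ m.+1) ^ b)%N].
Proof.
move=> b0 Mn; pose P m := (2 * (2 ^ m) ^ b <= n)%N.
have ub m : P m -> (m <= n)%N.
  move=> Pm; apply: ltnW; apply: leq_trans (ltn_expl m (isT : (1 < 2)%N)) _.
  apply: leq_trans Pm; apply: (@leq_trans ((2 ^ m) ^ b)); last by rewrite leq_pmull.
  by rewrite -{1}[(2 ^ m)%N]expn1 leq_pexp2l // expn_gt0.
have exP : exists m, P m by exists M.
case: (ex_maxnP exP ub) => m Pm mmax; exists m; split=> //; first exact: mmax.
by rewrite ltnNge; apply/negP => /mmax; rewrite ltnn.
Qed.

Lemma pow_lower T a b : (0 < a)%N -> (a <= b)%N ->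
  (b * #|inner T| <= a * #|edge T|)%N ->
  exists p c N, [/\ (0 < p)%N, 0 < c & forall n, (N <= n)%N ->
    c * Rpower (INR n) (2 - INR a / INR b) <= INR (ex n (pow_rel T p))].
Proof.
move=> a0 ab; have b0 : (0 < b)%N by apply: leq_trans ab.
rewrite -{1}(subnKC ab) => /ex_pow_ge[p [M [p0 H]]]; rewrite subnKC // in H.
have bR := INR_pos b0; have aR := INR_pos a0; have abR := INR_leq ab.
(* Passing from [m] to [m.+1] multiplies the order of the host by [2 ^ b], so
   [n < k * (2 ^ m) ^ b]. *)
pose k := INR (2 * 2 ^ b)%N; pose r := 2 - INR a / INR b.
have k0 : 0 < k by apply: INR_pos; rewrite muln_gt0 expn_gt0.
have ab1 : INR a / INR b <= 1.
  by apply: (Rmult_le_reg_r (INR b)) => //; rewrite /Rdiv Rmult_assoc Rinv_l; lra.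
exists p, (/ 2 * Rpower (/ k) r), (2 * (2 ^ M) ^ b)%N; split=> //.
  by apply: Rmult_lt_0_compat; [lra|apply: exp_pos].
move=> n nM; have [m [Mm mn nm]] := dyadic_scale b0 nM.
have n0 : 0 < INR n by apply: INR_pos; apply: leq_trans nM; rewrite muln_gt0 !expn_gt0.
have := INR_leq (H m n Mm mn).
rewrite INR_expn_Rpower ?expn_gt0 // INR_muln -[INR 2]/(1 + 1).
have E : Rpower (INR (2 ^ m)) (INR (b + (b - a))) = Rpower (INR ((2 ^ m) ^ b)%N) r.
  rewrite [in RHS]INR_expn_Rpower ?expn_gt0 // Rpower_mult; congr (Rpower _ _).
  rewrite INR_addn minus_INR; last by apply/leP.
  by rewrite /r; field; lra.
have le : / k * INR n <= INR ((2 ^ m) ^ b)%N.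
  apply: (Rmult_le_reg_l k) => //; rewrite -Rmult_assoc Rinv_r ?Rmult_1_l; last lra.
  rewrite /k -INR_muln; apply: INR_leq; apply: ltnW; move: nm.
  by rewrite expnS expnMn mulnA.
have ik := Rinv_0_lt_compat _ k0.
have h : Rpower (/ k) r * Rpower (INR n) r <= Rpower (INR ((2 ^ m) ^ b)) r.
  rewrite Rpower_mult_distr //; apply: Rle_Rpower_l; first by rewrite /r; lra.
  by split=> //; apply: Rmult_lt_0_compat.
rewrite E; rewrite -/r; lra.
Qed.

(** * Reaching every exponent below 2 *)

Definition subdivision_hypothesis : Prop :=
  forall (V : finType) (e : rel V), simple_graph e -> bipartite e ->
     forall alpha : R, 0 < alpha ->
       bigO (fun n => INR (ex n e)) (fun n => Rpower (INR n) (1 + alpha)) ->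
       bigO (fun n => INR (ex n (sub_rel e)))
            (fun n => Rpower (INR n) (1 + alpha / 2)).

Lemma bigO_le (f f' g : nat -> R) : (forall n, f n <= f' n) -> bigO f' g -> bigO f g.
Proof. by move=> ff [C [N h]]; exists C, N => n /h; apply: Rle_trans. Qed.

(** Induction on [a + b]: a ratio [a / b] up to 1/2 comes from [a / (b - a)] by a cone, a larger one
    below 1 from [(2a - b) / b] by subdivision. *)
Lemma pow_upper (hyp : subdivision_hypothesis) a b : (0 < a)%N -> (a <= b)%N ->
  exists T, (b * #|inner T| <= a * #|edge T|)%N /\
    forall p, (0 < p)%N -> bigO (fun n => INR (ex n (pow_rel T p)))
      (fun n => Rpower (INR n) (1 + (1 - INR a / INR b))).
Proof.
have [s] := ubnP (a + b)%N; elim: s a b => // s IH a b; rewrite ltnS => abs a0 ab.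
have b0 : (0 < b)%N by apply: leq_trans ab.
have bR := INR_pos b0; have aR := INR_pos a0; have abR := INR_leq ab.
case: (eqVneq a b) => [E|ne].
  exists rstar; rewrite E; split.
    by rewrite leq_mul2l card_unit card_edge_rstar orbT.
  move=> p p0; exists (INR p), 1%N => n /leP n1.
  have -> : 1 + (1 - INR b / INR b) = 1 by field; lra.
  rewrite Rpower_1; last by apply: INR_pos.
  by rewrite -INR_muln; apply: INR_leq; apply: ex_rstar.
have ltab : (a < b)%N by rewrite ltn_neqAle ne.
have ltabR := INR_ltn ltab.
case: (leqP (a + a) b) => h2.
  have [||| T [dT uT]] := IH a (b - a)%N; try lia.
  have baR : INR (b - a)%N = INR b - INR a by rewrite minus_INR //; apply/leP.
  exists (cone T); split.
    apply: (@leq_trans (a * (#|edge T| + #|inner T|))); last by rewrite leq_mul2l card_edge_cone orbT.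
    rewrite mulnDr; apply: (@leq_trans ((b - a) * #|inner T| + a * #|inner T|)).
      by rewrite -mulnDl subnK.
    by rewrite leq_add2r.
  move=> p p0; have h2R := INR_leq h2; rewrite INR_addn in h2R.
  have := cone_asymptotic p0 _ (uT p p0); rewrite baR.
  have -> : / (2 - (1 - INR a / (INR b - INR a))) = 1 - INR a / INR b by field; lra.
  (* The cone needs [alpha >= 0], that is [2a <= b]. *)
  apply; split.
    suff : INR a / (INR b - INR a) <= 1 by lra.
    by apply: (Rmult_le_reg_r (INR b - INR a)); [lra|rewrite /Rdiv Rmult_assoc Rinv_l; lra].
  suff : 0 < INR a / (INR b - INR a) by lra.
  by apply: Rdiv_lt_0_compat; lra.
have [||| T [dT uT]] := IH (a + a - b)%N b; try lia.
have aabR : INR (a + a - b)%N = INR a + INR a - INR b.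
  by rewrite minus_INR ?INR_addn //; apply/leP/ltnW.
exists (rsub T); split.
  rewrite card_inner_rsub; apply: (@leq_trans (a * (2 * #|edge T|))).
    rewrite mulnDr; apply: (@leq_trans ((a + a - b) * #|edge T| + b * #|edge T|)).
      by rewrite leq_add2r.
    by rewrite -mulnDl subnK ?(ltnW h2) // mulnA muln2 addnn.
  by rewrite leq_mul2l card_edge_rsub orbT.
move=> p p0.
apply: (@bigO_le _ (fun n => INR (ex n (sub_rel (pow_rel T p))))).
  by move=> n; apply: INR_leq; apply: ex_embeds; apply: pow_rsub_embeds.
have := hyp _ _ (pow_simple T p) (pow_bipartite T p) _ _ (uT p p0); rewrite aabR.
have -> : (1 - (INR a + INR a - INR b) / INR b) / 2 = 1 - INR a / INR b by field; lra.
apply; have -> : 1 - (INR a + INR a - INR b) / INR b = (2 * (INR b - INR a)) / INR b by field; lra.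
by apply: Rdiv_lt_0_compat; lra.
Qed.

(** * The exponent 2 and the conclusion *)

Lemma triangle_theta :
  bigTheta (fun n => INR (ex n (fun x y : 'I_3 => x != y))) (fun n => Rpower (INR n) 2).
Proof.
exists (/ 32), 1, 2%N; split; first lra; move=> n /leP n2.
have n2R : 2 <= INR n by apply: (INR_leq n2).
have -> : Rpower (INR n) 2 = INR n * INR n.
  by rewrite -[X in Rpower _ X]/(INR 2) Rpower_pow /=; lra.
split; last first.
  rewrite Rmult_1_l -INR_muln; apply: INR_leq; apply/bigmax_leqP => G _.
  by rewrite /nedges (leq_trans (max_card _)) // card_prod card_ord.
(* The balanced complete bipartite graph; [n <= 4 * n./2] then yields the constant 1/32. *)
pose g (x y : bool * 'I_(n./2)) := x.1 != y.1.
have lower : (n./2 * n./2 <= 2 * ex n (fun x y : 'I_3 => x != y))%N.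
  apply: (@leq_trans #|[set q | g q.1 q.2]|); last first.
    apply: (@card_rel_le_ex _ _ _ g setT) => //.
    - by move=> x; case: (eqVneq x ord0) => [->|ne]; [exists ord_max|exists ord0; rewrite ne].
    - by move=> x; rewrite /g eqxx.
    - by move=> x y; rewrite /g eq_sym.
    - by rewrite cardsT card_prod card_bool card_ord mul2n -[leqRHS]odd_double_half leq_addl.
    move=> [f [_ fe]].
    have := fe ord0 (lift ord0 ord0) isT; have := fe ord0 ord_max isT.
    have := fe (lift ord0 ord0) ord_max isT; rewrite /g.
    by case: (f _).1; case: (f _).1; case: (f _).1.
  pose h (q : 'I_(n./2) * 'I_(n./2)) := ((false, q.1), (true, q.2)).
  have hI : injective h by move=> [i j] [i' j'] [-> ->].
  rewrite -{1 2}[n./2]card_ord -card_prod -cardsT -(card_imset _ hI); apply: subset_leq_card.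
  by apply/subsetP => _ /imsetP[q _ ->]; rewrite inE.
have := INR_leq lower; rewrite !INR_muln -[INR 2]/(1 + 1).
have : INR n <= 4 * INR n./2.
  have -> : 4 = INR 4 by rewrite /=; lra.
  by rewrite -INR_muln; apply: INR_leq; lia.
nra.
Qed.
Theorem theorem1p7 :
  (forall (V : finType) (e : rel V), simple_graph e -> bipartite e ->
     forall alpha : R, 0 < alpha ->
       bigO (fun n => INR (ex n e)) (fun n => Rpower (INR n) (1 + alpha)) ->
       bigO (fun n => INR (ex n (sub_rel e)))
            (fun n => Rpower (INR n) (1 + alpha / 2))) ->
  forall r : Q, Qle 1 r -> Qle r 2 ->
    exists (V : finType) (e : rel V), simple_graph e /\
      bigTheta (fun n => INR (ex n e)) (fun n => Rpower (INR n) (Q2R r)).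
Proof.
move=> hyp r r1 r2.
have {}r1 : 1 <= Q2R r by move/Qle_Rle: r1; rewrite RMicromega.Q2R_1.
have {}r2 : Q2R r <= 2 by move/Qle_Rle: r2; rewrite [Q2R 2]/Q2R /=; lra.
(* Write [r = 2 - a / b] with [b] the denominator of [r]; then [0 <= a <= b], and [a = 0] is the
   exponent 2. *)
pose b := Pos.to_nat (Qden r); pose z := Z.sub (Z.mul 2 (Z.pos (Qden r))) (Qnum r).
have bE : INR b = IZR (Z.pos (Qden r)) by rewrite /b INR_IZR_INZ positive_nat_Z.
have b0 : (0 < b)%N by apply/ltP; apply: Pos2Nat.is_pos.
have bR := INR_pos b0.
have zE : IZR z = (2 - Q2R r) * INR b.
  by rewrite minus_IZR mult_IZR /Q2R bE /=; field; rewrite -bE; lra.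
pose a := Z.to_nat z.
have aE : INR a = (2 - Q2R r) * INR b.
  by rewrite -zE /a INR_IZR_INZ Z2Nat.id //; apply: le_IZR; rewrite zE; nra.
have rE : Q2R r = 2 - INR a / INR b by rewrite aE; field; lra.
have [a0|a0] := posnP a.
  exists 'I_3, (fun x y : 'I_3 => x != y); split.
    by split=> [x|x y]; rewrite ?eqxx // eq_sym.
  have -> : Q2R r = 2 by rewrite rE a0 /=; field; lra.
  exact: triangle_theta.
have ab : (a <= b)%N by apply/leP/INR_le; rewrite aE; nra.
have [T [dT uT]] := pow_upper hyp a0 ab.
have [p [c [N [p0 c0 lo]]]] := pow_lower a0 ab dT.
exists _, (pow_rel T p); split; first exact: pow_simple.
have [C [N' up]] := uT p p0.
exists c, C, (maxn N N'); split=> // n /leP; rewrite geq_max => /andP[nN nN'].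
rewrite rE; split; first exact: lo.
by have := up n (elimT leP nN'); congr (_ <= _ * Rpower _ _); lra.
Qed.
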